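(* Let $E$ be the fundamental group of the sapphire manifold defined by a matrix $B\in GL_2(\mathbb{Z})$ with $\det B=1$ and all four entries nonzero, and let $\theta(1)$, $M_0$, $\mathrm{Aut}_0^1(E)$ be as described in the context. I) If $\mathrm{Aut}_0^1(E)=\emptyset$ and $B=\begin{pmatrix} r&s\\ t&u\end{pmatrix}$, then $$\mathrm{Out}(E)=\langle \alpha,\beta,\rho \mid \alpha^2=\beta^{2s}=\rho^2=1,\ \alpha\beta=\beta\alpha,\ \rho\alpha\rho=\alpha,\ \rho\beta\rho=\beta^{-1}\rangle ,$$ hence $\mathrm{Out}(E)\cong(\mathbb{Z}_2\oplus\mathbb{Z}_{2s})\rtimes_{-1}\mathbb{Z}_2$. II) If $\mathrm{Aut}_0^1(E)\neq\emptyset$ and $\theta(1)=M_0^{\ell_0}=(M_0^{\ell})^2$ with $\det(M_0^\ell)=1$, $M_0^\ell=\begin{pmatrix} r&s\\ t&r\end{pmatrix}$, and the sapphire is defined by $B=\begin{pmatrix} r&-t\\ -s&r\end{pmatrix}$, then $$\mathrm{Out}(E)\cong[(\mathbb{Z}_2\oplus\mathbb{Z}_{2t})\rtimes_{-1}\mathbb{Z}_2]\rtimes_\omega\mathbb{Z}_2,$$ where, with $\alpha,\beta,\rho$ the standard generators of $\mathbb{Z}_2$, $\mathbb{Z}_{2t}$ and the inner $\mathbb{Z}_2$ factor respectively and $\omega$ the generator of the last $\mathbb{Z}_2$, $$\omega\alpha\omega^{-1}=\alpha^r\beta^{st},\qquad \omega\beta\omega^{-1}=\alpha\beta^r,\qquad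 \omega\rho\omega^{-1}=\alpha^t\beta^{t(r+1)}\rho .$$ III) If $\mathrm{Aut}_0^1(E)\neq\emptyset$ and $\theta(1)=-M_0^{\ell_0}=-(M_0^\ell)^2$ with $\det(M_0^\ell)=-1$, $M_0^\ell=\begin{pmatrix} r&s\\ t&r\end{pmatrix}$, and the sapphire is defined by $B=\begin{pmatrix} r&-t\\ s&-r\end{pmatrix}$, then there is a short exact sequence $$1\to(\mathbb{Z}_2\oplus\mathbb{Z}_{2t})\rtimes_{-1}\mathbb{Z}_2\to \mathrm{Out}(E)\to\mathbb{Z}_2\to1$$ and a presentation of $\mathrm{Out}(E)$ is $$\mathrm{Out}(E)=\langle\alpha,\beta,\rho,\omega\mid \alpha^2=\beta^{2t}=\rho^2=1,\ \alpha\beta=\beta\alpha,\ \rho\alpha\rho=\alpha,\ \rho\beta\rho=\beta^{-1},\ \omega^2=\beta^t\rho,\ \omega\alpha\omega^{-1}=\alpha^r\beta^{st},\ \omega\beta\omega^{-1}=\alpha\beta^r,\ \omega\rho\omega^{-1}=\alpha^t\beta^{t(r+1)}\rho\rangle .$$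
   Context: $\mathbb{Z}_n=\mathbb{Z}/n\mathbb{Z}$; $\rtimes_{-1}\mathbb{Z}_2$ means the generator acts by inversion. For $B=\begin{pmatrix} B_{11}&B_{12}\\ B_{21}&B_{22}\end{pmatrix}\in GL_2(\mathbb{Z})$ with $\det B=1$ and all entries nonzero, put $$\theta=\theta(1)=\begin{pmatrix} B_{11}B_{22}+B_{12}B_{21}&-2B_{11}B_{21}\\ -2B_{12}B_{22}&B_{11}B_{22}+B_{12}B_{21}\end{pmatrix},$$ an Anosov matrix. The fundamental group of the sapphire defined by $B$ is $$E=\langle d,b,v,a\mid db=bd,\ vdv^{-1}=\theta(d),\ vbv^{-1}=\theta(b),\ a^2=d,\ ab=b^{-1}a,\ ava^{-1}=d^{\,B_{11}-B_{11}B_{22}-B_{12}B_{21}}\,b^{\,B_{12}-2B_{12}B_{22}}\,v^{-1}\rangle,$$ where $d^xb^y$ is identified with the column vector $\begin{pmatrix} x \\ y \end{pmatrix}$. The subgroup $\langle d,b,v\rangle\cong(\mathbb{Z}\oplus\mathbb{Z})\rtimes_\theta\mathbb{Z}$ is characteristic of index $2$ in $E$, and $\langle d,b\rangle\cong\mathbb{Z}\oplus\mathbb{Z}$ is characteristic in it. $\mathrm{Aut}_0(E)$ is the group of automorphisms of $E$ that induce the identity on $\langle d,b,v\rangle/\langle d,b\rangle\cong\mathbb{Z}$, and $\mathrm{Aut}_0^1(E)$ is the set of $\varphi\in \mathrm{Aut}_0(E)$ with $\varphi(a)=d^mb^nva$ for some $m,n\in\mathbb{Z}$. $M_0\in GL_2(\mathbb{Z})$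 denotes a matrix such that the centralizer of $\theta(1)$ in $GL_2(\mathbb{Z})$ is $\{\pm M_0^i: i\in\mathbb{Z}\}\cong\mathbb{Z}_2\oplus\mathbb{Z}$; $\ell_0=2\ell$ are integers. $\mathrm{Out}(E)=\mathrm{Aut}(E)/\mathrm{Inn}(E)$. *)

(* Defs.v *)
From HB Require Import structures.
From mathcomp Require Import all_boot all_order all_algebra all_fingroup.
From mathcomp Require Import generic_quotient boolp classical_sets.
Set Implicit Arguments.
Unset Strict Implicit.
Unset Printing Implicit Defensive.
Import GroupScope.
Local Open Scope classical_set_scope.
Local Open Scope group_scope.

Definition isomorphic (G H : groupType) : Prop :=
  exists f : {multiplicative G -> H}, bijective f.

(* Integer powers; monoid.v only has natural ones. *)
Definition expgz (G : groupType) (x : G) (n : int) : G :=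
  match n with Posz m => x ^+ m | Negz m => x ^- m.+1 end.

Notation "x ^z n" := (expgz x n) (at level 29, left associativity) : group_scope.

Inductive subgroup_gen (G : groupType) (S : set G) : set G :=
| subgroup_gen_in x : S x -> subgroup_gen S x
| subgroup_gen_1 : subgroup_gen S 1
| subgroup_gen_M x y : subgroup_gen S x -> subgroup_gen S y -> subgroup_gen S (x * y)
| subgroup_gen_V x : subgroup_gen S x -> subgroup_gen S x^-1.

Section Presentations.

(* Formal group expressions in generators from T. *)
Inductive gterm (T : Type) : Type :=
| TVar of T
| TOne
| TMul of gterm T & gterm T
| TInv of gterm T.

Definition tpow T (x : gterm T) (n : int) : gterm T :=
  match n with
  | Posz m => iter m (TMul x) (TOne T)
  | Negz m => TInv (iter m.+1 (TMul x) (TOne T))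
  end.

HB.instance Definition _ T := gen_eqMixin (gterm T).
HB.instance Definition _ T := gen_choiceMixin (gterm T).

Variables (T : Type) (R : set (gterm T * gterm T)).

(* The least congruence containing the group axioms and the relations R. *)
Inductive gcong : gterm T -> gterm T -> Prop :=
| gcong_rel s t : R (s, t) -> gcong s t
| gcong_refl s : gcong s s
| gcong_sym s t : gcong s t -> gcong t s
| gcong_trans s t u : gcong s t -> gcong t u -> gcong s u
| gcong_mul s s' t t' :
    gcong s s' -> gcong t t' -> gcong (TMul s t) (TMul s' t')
| gcong_inv s s' : gcong s s' -> gcong (TInv s) (TInv s')
| gcong_mulA s t u : gcong (TMul s (TMul t u)) (TMul (TMul s t) u)
| gcong_mul1 s : gcong (TMul (TOne T) s) s
| gcong_1mul s : gcong (TMul s (TOne T)) s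
| gcong_mulV s : gcong (TMul (TInv s) s) (TOne T)
| gcong_Vmul s : gcong (TMul s (TInv s)) (TOne T).

Definition gcongb : rel (gterm T) := fun s t => `[< gcong s t >].

Lemma gcongb_refl : reflexive gcongb.
Proof. by move=> s; apply/asboolP/gcong_refl. Qed.

Lemma gcongb_sym : symmetric gcongb.
Proof. by move=> s t; apply/asboolP/asboolP => /gcong_sym. Qed.

Lemma gcongb_trans : transitive gcongb.
Proof.
by move=> t s u /asboolP st /asboolP tu; apply/asboolP/(gcong_trans st tu).
Qed.

Definition gcong_equiv : equiv_rel (gterm T) :=
  EquivRel gcongb gcongb_refl gcongb_sym gcongb_trans.

(* The group < T | R >. *)
Definition presented : Type := {eq_quot gcong_equiv}%qT.

HB.instance Definition _ := Choice.on presented.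
HB.instance Definition _ := EqQuotient.on presented.

Definition pclass (s : gterm T) : presented := (\pi_presented s)%qT.
Definition pgen (i : T) : presented := pclass (TVar i).

Lemma pclassP s t : pclass s = pclass t <-> gcong s t.
Proof. by split=> [/eqquotP/asboolP|st] //; apply/eqquotP/asboolP. Qed.

Lemma pclass_repr (x : presented) : pclass (repr x) = x.
Proof. exact: reprK. Qed.

Definition pmul (x y : presented) := pclass (TMul (repr x) (repr y)).
Definition pone : presented := pclass (TOne T).
Definition pinv (x : presented) := pclass (TInv (repr x)).

Lemma pclassM s t : pclass (TMul s t) = pmul (pclass s) (pclass t).
Proof.
apply/pclassP; apply: gcong_mul; apply/pclassP; by rewrite pclass_repr.
Qed.

Lemma pclassV s : pclass (TInv s) = pinv (pclass s).
Proof. by apply/pclassP/gcong_inv/pclassP; rewrite pclass_repr. Qed.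

Lemma pmulA : associative pmul.
Proof.
move=> x y z; rewrite -(pclass_repr x) -(pclass_repr y) -(pclass_repr z).
by rewrite -!pclassM; apply/pclassP/gcong_mulA.
Qed.

Lemma pmul1 : left_id pone pmul.
Proof.
move=> x; rewrite -{1}(pclass_repr x) -[RHS]pclass_repr -pclassM.
exact/pclassP/gcong_mul1.
Qed.

Lemma p1mul : right_id pone pmul.
Proof.
move=> x; rewrite -{1}(pclass_repr x) -[RHS]pclass_repr -pclassM.
exact/pclassP/gcong_1mul.
Qed.

Lemma pmulV : left_inverse pone pinv pmul.
Proof.
move=> x; rewrite -(pclass_repr x) -pclassV -pclassM.
exact/pclassP/gcong_mulV.
Qed.

Lemma pVmul : right_inverse pone pinv pmul.
Proof.
move=> x; rewrite -(pclass_repr x) -pclassV -pclassM.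
exact/pclassP/gcong_Vmul.
Qed.

HB.instance Definition _ :=
  isGroup.Build presented pmulA pmul1 p1mul pmulV pVmul.

(* The family x of elements of G gives a presentation G = < x | R >. *)
Definition presents (G : groupType) (x : T -> G) : Prop :=
  exists f : {multiplicative presented -> G},
    bijective f /\ forall i, f (pgen i) = x i.

End Presentations.

Declare Scope gterm_scope.
Delimit Scope gterm_scope with gt.
Bind Scope gterm_scope with gterm.
Notation "1" := (TOne _) : gterm_scope.
Notation "s * t" := (TMul s t) : gterm_scope.
Notation "s ^-1" := (TInv s) : gterm_scope.
Notation "s ^z n" := (tpow s n) (at level 29, left associativity) : gterm_scope.
Notation "s =r t" := (pair s%gt t%gt) (at level 70, no associativity).

Section Automorphisms.

Record autom (G : groupType) := Autom {
  autom_fun :> G -> G;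
  automM : {morph autom_fun : x y / x * y};
  autom_bij : bijective autom_fun }.

HB.instance Definition _ G := gen_eqMixin (autom G).
HB.instance Definition _ G := gen_choiceMixin (autom G).

Variable G : groupType.

Lemma automP (f g : autom G) : (forall x, f x = g x) -> f = g.
Proof.
case: f g => [f fM fB] [g gM gB] /= /funext fg.
by case: _ / fg in gM gB *; congr Autom; apply: Prop_irrelevance.
Qed.

Definition autom_one : autom G :=
  @Autom G id (fun _ _ => erefl) (inv_bij (fun _ => erefl)).

Lemma autom_comp_morph (f g : autom G) : {morph f \o g : x y / x * y}.
Proof. by move=> x y /=; rewrite !automM. Qed.

Definition autom_mul (f g : autom G) : autom G :=
  Autom (autom_comp_morph f g) (bij_comp (autom_bij f) (autom_bij g)).

Lemma autom_inv_ex (f : autom G) : exists g : autom G, cancel f g /\ cancel g f.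
Proof.
have [g fK gK] := autom_bij f.
have gM : {morph g : x y / x * y}.
  by move=> x y; apply: (can_inj fK); rewrite automM !gK.
by exists (Autom gM (Bijective gK fK)).
Qed.

Definition autom_inv (f : autom G) : autom G := projT1 (cid (autom_inv_ex f)).

Lemma autom_invK (f : autom G) : cancel f (autom_inv f).
Proof. by rewrite /autom_inv; case: cid => g []. Qed.

Lemma autom_Kinv (f : autom G) : cancel (autom_inv f) f.
Proof. by rewrite /autom_inv; case: cid => g []. Qed.

Lemma autom_mulA : associative autom_mul.
Proof. by move=> f g h; apply: automP. Qed.
Lemma autom_mul1 : left_id autom_one autom_mul.
Proof. by move=> f; apply: automP. Qed.
Lemma autom_1mul : right_id autom_one autom_mul.
Proof. by move=> f; apply: automP. Qed.
Lemma autom_mulV : left_inverse autom_one autom_inv autom_mul.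
Proof. by move=> f; apply: automP => x; apply: autom_invK. Qed.
Lemma autom_Vmul : right_inverse autom_one autom_inv autom_mul.
Proof. by move=> f; apply: automP => x; apply: autom_Kinv. Qed.

HB.instance Definition _ := isGroup.Build (autom G)
  autom_mulA autom_mul1 autom_1mul autom_mulV autom_Vmul.

Definition inner : set (autom G) :=
  [set f | exists g : G, forall x, f x = g * x * g^-1].

Lemma inner1 : inner 1.
Proof. by exists 1 => x; rewrite mul1g invg1 mulg1. Qed.

Lemma innerM f g : inner f -> inner g -> inner (f * g).
Proof.
move=> [u fE] [w gE]; exists (u * w) => x.
by rewrite [LHS](_ : _ = f (g x)) // fE gE invgM !mulgA.
Qed.

Lemma innerV f : inner f -> inner f^-1.
Proof.
move=> [u fE]; exists u^-1 => x; apply: (can_inj (autom_invK f)).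
by rewrite [LHS]autom_Kinv fE invgK !mulgA mulgV mul1g mulgK.
Qed.

Lemma innerJ f g : inner f -> inner (g * f * g^-1).
Proof.
move=> [u fE]; exists (g u) => x.
rewrite [LHS](_ : _ = g (f (autom_inv g x))) // fE !automM autom_Kinv.
congr (_ * _); apply: (mulgI (g u)); rewrite -automM !mulgV.
by apply: (mulgI (g 1)); rewrite -automM !mulg1.
Qed.

Definition outb : rel (autom G) := fun f g => `[< inner (f^-1 * g) >].

Lemma outb_refl : reflexive outb.
Proof. by move=> f; apply/asboolP; rewrite mulVg; apply: inner1. Qed.

Lemma outb_sym : symmetric outb.
Proof.
by move=> f g; apply/asboolP/asboolP => /innerV; rewrite invgM invgK.
Qed.

Lemma outb_trans : transitive outb.
Proof.
move=> g f h /asboolP fg /asboolP gh; apply/asboolP.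
by have := innerM fg gh; rewrite mulgA mulgK.
Qed.

Definition out_equiv : equiv_rel (autom G) :=
  EquivRel outb outb_refl outb_sym outb_trans.

(* Out(G) = Aut(G) / Inn(G), as the set of cosets f Inn(G). *)
Definition outer : Type := {eq_quot out_equiv}%qT.

HB.instance Definition _ := Choice.on outer.
HB.instance Definition _ := EqQuotient.on outer.

Definition oclass (f : autom G) : outer := (\pi_outer f)%qT.

Lemma oclassP f g : oclass f = oclass g <-> inner (f^-1 * g).
Proof. by split=> [/eqquotP/asboolP|fg] //; apply/eqquotP/asboolP. Qed.

Lemma oclass_repr (x : outer) : oclass (repr x) = x.
Proof. exact: reprK. Qed.

Definition omul (x y : outer) := oclass (repr x * repr y).
Definition oone : outer := oclass 1.
Definition oinv (x : outer) := oclass (repr x)^-1.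

Lemma oclassM f g : oclass (f * g) = omul (oclass f) (oclass g).
Proof.
rewrite /omul; apply/oclassP.
set f' := repr (oclass f); set g' := repr (oclass g).
have ff : inner (f^-1 * f') by apply/oclassP; rewrite oclass_repr.
have gg : inner (g^-1 * g') by apply/oclassP; rewrite oclass_repr.
have := innerM (innerJ g^-1 ff) gg.
by rewrite invgM invgK !mulgA mulgK.
Qed.

Lemma oclassV f : oclass f^-1 = oinv (oclass f).
Proof.
rewrite /oinv; apply/oclassP; set f' := repr (oclass f).
have ff : inner (f^-1 * f') by apply/oclassP; rewrite oclass_repr.
have := innerJ f (innerV ff).
by rewrite invgK invgM invgK !mulgA mulgK.
Qed.

Lemma omulA : associative omul.
Proof.
move=> x y z; rewrite -(oclass_repr x) -(oclass_repr y) -(oclass_repr z).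
by rewrite -!oclassM mulgA.
Qed.
Lemma omul1 : left_id oone omul.
Proof. by move=> x; rewrite -(oclass_repr x) -oclassM mul1g. Qed.
Lemma o1mul : right_id oone omul.
Proof. by move=> x; rewrite -(oclass_repr x) -oclassM mulg1. Qed.
Lemma omulV : left_inverse oone oinv omul.
Proof. by move=> x; rewrite -(oclass_repr x) -oclassV -oclassM mulVg. Qed.
Lemma oVmul : right_inverse oone oinv omul.
Proof. by move=> x; rewrite -(oclass_repr x) -oclassV -oclassM mulgV. Qed.

HB.instance Definition _ :=
  isGroup.Build outer omulA omul1 o1mul omulV oVmul.

End Automorphisms.

Section Semidirect.

Variables N H : groupType.

(* act is a phantom parameter of the carrier N * H: it selects the group law. *)
Record semidirect_of (act : {multiplicative H -> autom N}) :=
  SdPair { sd_fst : N; sd_snd : H }.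

Variable act : {multiplicative H -> autom N}.

Local Notation semidirect := (semidirect_of act).
Local Notation Semidirect := (@SdPair act).

Definition sd_pair (x : semidirect) := (sd_fst x, sd_snd x).
Definition pair_sd (x : N * H) : semidirect := Semidirect x.1 x.2.
Lemma sd_pairK : cancel sd_pair pair_sd. Proof. by case. Qed.

HB.instance Definition _ := Choice.copy semidirect (can_type sd_pairK).

Definition sd_mul (x y : semidirect) : semidirect :=
  Semidirect (sd_fst x * act (sd_snd x) (sd_fst y)) (sd_snd x * sd_snd y).
Definition sd_one : semidirect := Semidirect 1 1.
Definition sd_inv (x : semidirect) : semidirect :=
  Semidirect (act (sd_snd x)^-1 (sd_fst x)^-1) (sd_snd x)^-1.

Lemma act_mul h k n : act (h * k) n = act h (act k n).
Proof. by rewrite gmulfM. Qed.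

Lemma act_1 n : act 1 n = n.
Proof.
have [g gK _] := autom_bij (act 1).
by apply: (can_inj gK); rewrite -act_mul mulg1.
Qed.

Lemma autom_fun1 (G : groupType) (f : autom G) : f 1 = 1.
Proof. by apply: (mulgI (f 1)); rewrite -automM !mulg1. Qed.

Lemma sd_mulA : associative sd_mul.
Proof.
by move=> [n h] [m k] [p l]; rewrite /sd_mul /= automM act_mul !mulgA.
Qed.
Lemma sd_mul1 : left_id sd_one sd_mul.
Proof. by move=> [n h]; rewrite /sd_mul /= act_1 !mul1g. Qed.
Lemma sd_1mul : right_id sd_one sd_mul.
Proof. by move=> [n h]; rewrite /sd_mul /= autom_fun1 !mulg1. Qed.
Lemma sd_mulV : left_inverse sd_one sd_inv sd_mul.
Proof.
by move=> [n h]; rewrite /sd_mul /= -automM !mulVg autom_fun1.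
Qed.
Lemma sd_Vmul : right_inverse sd_one sd_inv sd_mul.
Proof.
by move=> [n h]; rewrite /sd_mul /= -act_mul !mulgV act_1 mulgV.
Qed.

HB.instance Definition _ := isGroup.Build semidirect
  sd_mulA sd_mul1 sd_1mul sd_mulV sd_Vmul.

Definition semidirect_group : groupType := semidirect.

Definition sd_inl (n : N) : semidirect_group := Semidirect n 1.
Definition sd_inr (h : H) : semidirect_group := Semidirect 1 h.

End Semidirect.

Arguments semidirect_group {N H} act.
Arguments sd_inl {N H} act n.
Arguments sd_inr {N H} act h.

Section InversionAction.

Variables (A : groupType) (mulAC : forall x y : A, commute x y).

Lemma invg_morph : {morph (@inv A) : x y / x * y}.
Proof. by move=> x y; rewrite invgM mulAC. Qed.

Definition inv_autom : autom A := Autom invg_morph (inv_bij (@invgK A)).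

Definition inv_act (h : 'Z_2) : autom A := if h == 0%R then 1 else inv_autom.

Lemma inv_actM : {morph inv_act : h k / h * k}.
Proof.
have ii : inv_autom * inv_autom = 1 by apply: automP => x; apply: invgK.
case=> [[|[|//]] hh] [[|[|//]] hk]; rewrite /inv_act /= ?mul1g ?mulg1 //.
Qed.

HB.instance Definition _ :=
  isMultiplicative.Build ('Z_2 : groupType) (autom A) inv_act inv_actM.

End InversionAction.

Section DihedralType.

Variable n : nat.

(* 'Z_n is Z/nZ for 1 < n only; it is used below with n = `|2 * s|, s != 0. *)
Definition Z2n : groupType := ('Z_2 * 'Z_n)%type.

Lemma Z2n_comm (x y : Z2n) : commute x y.
Proof. by case: x y => [a b] [c e]; congr pair; apply: Zp_mulgC. Qed.

(* (Z/2 + Z/n) x|_{-1} Z/2 and its standard generators. *)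
Definition dih : groupType := semidirect_group (inv_act Z2n_comm).

Definition dih_alpha : dih := sd_inl (inv_act Z2n_comm) ((1%R, 0%R) : Z2n).
Definition dih_beta : dih := sd_inl (inv_act Z2n_comm) ((0%R, 1%R) : Z2n).
Definition dih_rho : dih := sd_inr (inv_act Z2n_comm) (1%R : 'Z_2).

End DihedralType.

Definition short_exact (N G Q : groupType)
    (i : {multiplicative N -> G}) (p : {multiplicative G -> Q}) : Prop :=
  [/\ injective i,
      forall g, p g = 1 <-> exists n, i n = g
    & forall q, exists g, p g = q].

Section Sapphire.

Definition mx22 (a b c d : int) : 'M[int]_2 :=
  \matrix_(i, j) (if i == 0 then (if j == 0 then a else b)
                  else (if j == 0 then c else d))%R.

Variable B : 'M[int]_2.
Local Notation B11 := (B 0%R 0%R).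
Local Notation B12 := (B 0%R 1%R).
Local Notation B21 := (B 1%R 0%R).
Local Notation B22 := (B 1%R 1%R).

Definition theta : 'M[int]_2 :=
  mx22 (B11 * B22 + B12 * B21) (- (2 * B11 * B21))
       (- (2 * B12 * B22)) (B11 * B22 + B12 * B21).

Inductive sapphire_gen := gd | gb | gv | ga.

Definition sapphire_rels : set (gterm sapphire_gen * gterm sapphire_gen) :=
  let d := TVar gd in let b := TVar gb in
  let v := TVar gv in let a := TVar ga in
  [set d * b =r b * d;
       v * d * v^-1 =r d ^z (theta 0%R 0%R) * b ^z (theta 1%R 0%R);
       v * b * v^-1 =r d ^z (theta 0%R 1%R) * b ^z (theta 1%R 1%R);
       a * a =r d;
       a * b =r b^-1 * a;
       a * v * a^-1 =r d ^z (B11 - B11 * B22 - B12 * B21)%R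
                       * b ^z (B12 - 2 * B12 * B22)%R * v^-1]%classic.

(* The fundamental group of the sapphire defined by B. In the relations d^x b^y
   is the column vector (x, y), so theta(d) and theta(b) are columns of theta. *)
Definition sapphire : groupType := presented sapphire_rels.

Definition sap_d : sapphire := pgen _ gd.
Definition sap_b : sapphire := pgen _ gb.
Definition sap_v : sapphire := pgen _ gv.
Definition sap_a : sapphire := pgen _ ga.

(* The automorphisms f inducing the identity on <d,b,v>/<d,b>, that is
   f x <d,b> = x <d,b> for x in <d,b,v>. *)
Definition aut0 : set (autom sapphire) :=
  [set f | forall x, subgroup_gen [set sap_d; sap_b; sap_v]%classic x ->
             subgroup_gen [set sap_d; sap_b]%classic (f x * x^-1)].

Definition aut01 : set (autom sapphire) :=
  [set f | aut0 f /\
    exists m n : int, f sap_a = sap_d ^z m * sap_b ^z n * sap_v * sap_a].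

End Sapphire.

Arguments aut0 B : clear implicits.
Arguments aut01 B : clear implicits.

(* The centralizer of A in GL_2(Z) is { +-M^i }, isomorphic to Z/2 + Z through
   (e, i) |-> (-1)^e M^i. *)
Definition centralizer_root (A M : 'M[int]_2) : Prop :=
  [/\ M \in unitmx,
      forall C : 'M[int]_2, C \in unitmx ->
        ((C *m A = A *m C)%R <->
         exists (e : bool) (i : int), C = ((-1) ^+ e *: M ^ i)%R)
    & injective (fun ei : bool * int => ((-1) ^+ ei.1 *: M ^ ei.2)%R)].

Inductive out_gen := galpha | gbeta | grho.

Definition out_rels (k : int) : set (gterm out_gen * gterm out_gen) :=
  let al := TVar galpha in let be := TVar gbeta in let rh := TVar grho in
  [set al * al =r 1; be ^z k =r 1; rh * rh =r 1;
       al * be =r be * al; rh * al * rh =r al; rh * be * rh =r be^-1]%classic.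

Inductive out4_gen := halpha | hbeta | hrho | homega.

Definition out4_rels (r s t : int) : set (gterm out4_gen * gterm out4_gen) :=
  let al := TVar halpha in let be := TVar hbeta in
  let rh := TVar hrho in let om := TVar homega in
  [set al * al =r 1; be ^z (2 * t)%R =r 1; rh * rh =r 1;
       al * be =r be * al; rh * al * rh =r al; rh * be * rh =r be^-1;
       om * om =r be ^z t * rh;
       om * al * om^-1 =r al ^z r * be ^z (s * t)%R;
       om * be * om^-1 =r al * be ^z r;
       om * rh * om^-1 =r al ^z t * be ^z (t * (r + 1))%R * rh]%classic.

(* Main.v *)
From HB Require Import structures.
Require Import Defs.
From mathcomp Require Import all_boot all_order all_algebra all_fingroup.
From mathcomp Require Import boolp classical_sets.
From mathcomp Require Import generic_quotient zify ring.
Import GroupScope.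
Local Open Scope classical_set_scope.
Local Open Scope group_scope.

Set Implicit Arguments.
Unset Strict Implicit.
Unset Printing Implicit Defensive.

(** The proof computes Out(E) by hand, from the extension of the infinite dihedral
    group by Z^2 that E is.

    Write T x y for d^x b^y, J for diag(1, -1), and (r, s; t, u) for the matrix of the
    sapphire. Conjugation by v acts on Z^2 = <d, b> by theta and conjugation by a acts
    by J. The quotient by Z^2 acts on the line of integers, v as a translation and a as
    a reflection; height is this action. Every element is a word T x y v^k a^e
    (normal_form), and T is injective because E acts on a lattice of Sol space
    (trans_eq1).

    Since theta is hyperbolic, Z^2 consists of the elements that commute with all their
    conjugates (trans_char). It is thus preserved by automorphisms, and an automorphism
    f acts on the dihedral quotient. Composing f with an inner automorphism, one
    may assume that f v = v and f a = v^c a there, with c in {0, 1}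
    (autom_normalize); c is the parity of f.

    If c = 0, then f commutes with theta and J on Z^2, so it is 1 or -1 there, and the
    relations of E leave two integer parameters: f is one of the automorphisms
    twist e n k (twist_complete). These form Z^2 x|_{-1} Z/2 (twistM), and the inner
    ones form the lattice spanned by (2, 2 r) and (0, 2 s) (inner_twist). The quotient
    is the group (Z/2 + Z/2s) x|_{-1} Z/2, generated by alpha = (1, r), beta = (0, 1)
    and a reflection rho. If Aut_0^1(E) is empty there is no f with c = 1, and this
    group is Out(E).

    In the two other cases B = (r, - t; - eps s, eps r), where M = (r, s; t, r) has
    determinant eps = 1 or -1. Then theta = eps M^2, and M conjugates J to theta J, the
    action of v a. Hence M extends to an automorphism omega with omega a = v a, of
    parity 1 (omega_exists). The twists have index two in Out(E), and it remains to
    compute how omega conjugates them (omega_twist) and that its square is, up to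
    conjugation by v, a twist (omega_sq), of sign eps. So omega^2 is trivial in Out(E)
    for eps = 1, where Out(E) is a semidirect product (split_extension), and beta^t rho
    for eps = -1, where the presentation follows from the index two subgroup
    (out4_presentation). *)

(** * Integer powers and group homomorphisms *)

Section IntegerPowers.

Implicit Types G H : groupType.

Lemma expgz1 G (x : G) : x ^z 1 = x.
Proof. by []. Qed.

Lemma expgzSr G (x : G) (n : int) : x ^z (n + 1)%R = x ^z n * x.
Proof.
case: n => [n|[|n]].
- by rewrite -PoszD addn1 /= expgSr.
- by rewrite (_ : (Negz 0 + 1 = 0)%R) //= mulVg.
have -> : (Negz n.+1 + 1 = Negz n)%R by lia.
by rewrite /= (expgS x n.+1) invgM mulgVK.
Qed.

Lemma expgzBr G (x : G) (n : int) : x ^z (n - 1)%R = x ^z n * x^-1.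
Proof. by rewrite -[n in RHS](GRing.subrK 1%R) expgzSr mulgK. Qed.

Lemma expgzD G (x : G) (m n : int) : x ^z (m + n)%R = x ^z m * x ^z n.
Proof.
elim/int_rect: n => [|n IHn|n IHn]; first by rewrite GRing.addr0 mulg1.
  have -> : (n.+1%:Z = n%:Z + 1)%R by lia.
  by rewrite GRing.addrA !expgzSr IHn mulgA.
have -> : (- n.+1%:Z = - n%:Z - 1)%R by lia.
by rewrite GRing.addrA !expgzBr IHn mulgA.
Qed.

Lemma expgzN G (x : G) (n : int) : x ^z (- n)%R = (x ^z n)^-1.
Proof. by apply/esym/mulg1_eq; rewrite -expgzD GRing.subrr. Qed.

(** The tool for every computation with integer exponents: an additive family
indexed by the integers is a family of powers, so exponent laws are checked on
additivity alone. *)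
Lemma additive_expgz G (h : int -> G) :
  (forall m n, h (m + n)%R = h m * h n) -> forall n, h n = h 1%R ^z n.
Proof.
move=> hD.
have h0 : h 0%R = 1 by apply: (mulgI (h 0%R)); rewrite -hD mulg1.
have hN m : h (- m)%R = (h m)^-1.
  by apply/esym/mulg1_eq; rewrite -hD GRing.subrr.
elim/int_rect => [|n IHn|n IHn] //; have -> : (n.+1%:Z = n%:Z + 1)%R by lia.
  by rewrite hD expgzSr IHn.
by rewrite GRing.opprD hD IHn expgzBr hN.
Qed.

Lemma expgzM G (x : G) (m n : int) : x ^z (m * n)%R = x ^z m ^z n.
Proof.
rewrite -[m in RHS]GRing.mulr1.
by apply: (@additive_expgz _ (fun n => x ^z (m * n)%R)) => i j; rewrite GRing.mulrDr expgzD.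
Qed.

Lemma expgzC G (x : G) (m n : int) : x ^z m * x ^z n = x ^z n * x ^z m.
Proof. by rewrite -!expgzD GRing.addrC. Qed.

Lemma commutez G (x y : G) (n : int) : commute x y -> commute x (y ^z n).
Proof.
by move=> xy; case: n => n; rewrite /expgz; [|apply: commuteV]; apply: commuteX.
Qed.

Section Morphism.

Variables (G H : groupType) (f : G -> H) (fM : {morph f : x y / x * y}).

Lemma gmorph1 : f 1 = 1.
Proof. by apply: (mulgI (f 1)); rewrite -fM !mulg1. Qed.

Lemma gmorphV : {morph f : x / x^-1}.
Proof. by move=> x; apply/esym/mulg1_eq; rewrite -fM mulgV gmorph1. Qed.

Lemma gmorph_gz (n : int) : {morph f : x / x ^z n}.
Proof.
move=> x; rewrite -[in RHS](expgz1 x).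
by apply: (@additive_expgz _ (fun n => f (x ^z n))) => i j; rewrite expgzD fM.
Qed.

Lemma gmorph_inj : (forall x, f x = 1 -> x = 1) -> injective f.
Proof.
move=> fI x y xy; apply/divg1_eq/fI; by rewrite fM gmorphV xy mulgV.
Qed.

Lemma gmorph_isomorphic : bijective f -> isomorphic G H.
Proof.
move=> fbij.
pose mix := isMultiplicative.Build G H f fM.
pose F : {multiplicative G -> H} := HB.pack f mix.
by exists F.
Qed.

End Morphism.

Lemma exists_morphism G H (f : G -> H) : {morph f : x y / x * y} ->
  exists g : {multiplicative G -> H}, g =1 f.
Proof.
move=> fM; pose mix := isMultiplicative.Build G H f fM.
pose F : {multiplicative G -> H} := HB.pack f mix.
by exists F.
Qed.

Lemma inj_surj_bij (S T : Type) (f : S -> T) :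
  injective f -> (forall y, exists x, f x = y) -> bijective f.
Proof.
move=> fI fS; pose g y := projT1 (cid (fS y)).
have gK y : f (g y) = y by rewrite /g; case: cid.
by exists g => // x; apply: fI.
Qed.

Lemma isomorphic_sym G H : isomorphic G H -> isomorphic H G.
Proof.
move=> [f fbij]; have [g fK gK] := fbij.
apply: (@gmorph_isomorphic _ _ g); last by exists f.
exact: can2_gmulfM fK gK.
Qed.

End IntegerPowers.

(** * Presentations *)

Section PresentationTheory.

Variable T : Type.

Fixpoint geval (G : groupType) (x : T -> G) (s : gterm T) : G :=
  match s with
  | TVar i => x i
  | TOne => 1
  | TMul s t => geval x s * geval x t
  | TInv s => (geval x s)^-1
  end.

Lemma geval_tpow (G : groupType) (x : T -> G) s (n : int) :
  geval x (tpow s n) = geval x s ^z n.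
Proof.
have iterE m : geval x (iter m (TMul s) (TOne T)) = geval x s ^+ m.
  by elim: m => //= m ->; rewrite -expgS.
by case: n => m; [apply: iterE | rewrite -[RHS]/((_ ^+ _)^-1) -iterE].
Qed.

Variable R : set (gterm T * gterm T).

Definition satisfies (G : groupType) (x : T -> G) :=
  forall s t, R (s, t) -> geval x s = geval x t.

Lemma geval_gcong (G : groupType) (x : T -> G) s t :
  satisfies x -> gcong R s t -> geval x s = geval x t.
Proof.
move=> xR; elim=> {s t} //=.
- by move=> s t u _ -> _ ->.
- by move=> s s' t t' _ -> _ ->.
- by move=> s s' _ ->.
- by move=> s t u; rewrite mulgA.
- by move=> s; rewrite mul1g.
- by move=> s; rewrite mulg1.
- by move=> s; rewrite mulVg.
- by move=> s; rewrite mulgV.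
Qed.

Lemma geval_pgen s : geval (pgen R) s = pclass R s.
Proof.
elim: s => //= [s -> t ->|s ->]; first by rewrite pclassM.
by rewrite pclassV.
Qed.

Lemma pgen_satisfies : satisfies (pgen R).
Proof. by move=> s t st; rewrite !geval_pgen; apply/pclassP/gcong_rel. Qed.

Lemma presented_ind (P : presented R -> Prop) :
  (forall i, P (pgen R i)) -> P 1 -> (forall x y, P x -> P y -> P (x * y)) ->
  (forall x, P x -> P x^-1) -> forall x, P x.
Proof.
move=> Pg P1 PM PV x; rewrite -(pclass_repr x) -geval_pgen.
by elim: (repr x) => //= [s Ps t Pt|s Ps]; [apply: PM | apply: PV].
Qed.

(** Universal property: a family satisfying the relations extends to a
homomorphism, because evaluation of terms is compatible with the congruence
generated by R. *)
Lemma presented_lift (G : groupType) (x : T -> G) : satisfies x ->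
  exists f : {multiplicative presented R -> G}, forall i, f (pgen R i) = x i.
Proof.
move=> xR; pose f (q : presented R) := geval x (repr q).
have fE s : f (pclass R s) = geval x s.
  by apply: geval_gcong => //; apply/pclassP; rewrite pclass_repr.
have fM : {morph f : p q / p * q}.
  move=> p q.
  by have := fE (TMul (repr p) (repr q)); rewrite pclassM !pclass_repr.
have [g gE] := exists_morphism fM.
by exists g => i; rewrite gE /pgen fE.
Qed.

Lemma presented_morph_eq (G : groupType) (f g : presented R -> G) :
  {morph f : x y / x * y} -> {morph g : x y / x * y} ->
  (forall i, f (pgen R i) = g (pgen R i)) -> f =1 g.
Proof.
move=> fM gM fg; apply: presented_ind => // [|x y Ex Ey|x Ex].
- by rewrite !gmorph1.
- by rewrite fM gM Ex Ey.
by rewrite !gmorphV // Ex.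
Qed.

End PresentationTheory.

(** * The groups (Z/2 + Z/n) x|_{-1} Z/2 *)

Section DihedralRecognition.

Lemma expg_Zp (G : groupType) (n : nat) (b : G) : 1 < n -> b ^+ n = 1 ->
  {morph (fun x : 'Z_n => b ^+ x) : x y / x * y >-> x * y}.
Proof.
move=> n1 bn x y /=; rewrite -expgnDr [in RHS](divn_eq (x + y) n) expgnDr mulnC.
by rewrite expgnA bn expg1n mul1g; congr (b ^+ (_ %% _)); apply: Zp_cast.
Qed.

(** The candidate homomorphism sending the standard generators to a, b and r,
written on normal forms alpha^i beta^j rho^h. *)
Definition dih_map (G : groupType) (n : nat) (a b r : G) (x : dih n) : G :=
  a ^+ (sd_fst x).1 * b ^+ (sd_fst x).2 * r ^+ (sd_snd x).

(** The exponent k is an integer of any sign, as in the presentations, while the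
cyclic factor of the group has order the absolute value of k. *)
Definition dih_relations (G : groupType) (k : int) (a b r : G) :=
  [/\ a * a = 1, b ^z k = 1, r * r = 1 & [/\ a * b = b * a, r * a * r = a & r * b * r = b^-1]].

Variables (G : groupType) (k : int) (a b r : G).
Hypotheses (k1 : 1 < `|k|%N) (rel : dih_relations k a b r).
Local Notation n := `|k|%N.

Lemma dih_b_order : b ^+ n = 1.
Proof.
have [_ + _ _] := rel; case: (k) => m //= bm.
by rewrite -[LHS]invgK bm invg1.
Qed.

Lemma dih_mapM : {morph @dih_map G n a b r : x y / x * y}.
Proof.
have [a2 _ r2 [ab ra rb]] := rel.
have aM := @expg_Zp G 2 a isT (a2 : a ^+ 2 = 1).
have rM := @expg_Zp G 2 r isT (r2 : r ^+ 2 = 1).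
have bM := expg_Zp k1 dih_b_order.
have rV : r^-1 = r by apply: mulg1_eq.
have raC : commute r a by rewrite /commute -{2}ra -!mulgA r2 mulg1.
(* Conjugation by r inverts every power of b, not only b itself. *)
have rX m : r * b ^+ m * r = b ^- m.
  elim: m => [|m IH]; first by rewrite mulg1 r2 invg1.
  rewrite [in RHS]expgSr invgM -IH -rb expgS !mulgA.
  by rewrite -(mulgA (r * b) r r) r2 mulg1.
move=> [[i j] h] [[i' j'] h']; rewrite /dih_map /=.
have rh : r ^+ h * a ^+ i' * b ^+ j' =
    a ^+ (inv_act (@Z2n_comm n) h (i', j')).1 *
    b ^+ (inv_act (@Z2n_comm n) h (i', j')).2 * r ^+ h.
  rewrite /inv_act; case: (eqVneq h 0%R) => [->|h0]; first by rewrite mulg1 mul1g.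
  have -> : h = 1%R by case: h h0 => [[|[|[]]]] // ? _; apply: val_inj.
  rewrite (gmorphV aM) (gmorphV bM) expg1 -rX.
  rewrite -(gmorphV aM) (_ : i'^-1 = i'); last by case: (i') => [[|[|[]]]] // ?; apply: val_inj.
  rewrite (commuteX i' raC) -!mulgA; congr (_ * _).
  by rewrite r2 mulg1.
move: rh; case: (inv_act _ _ _) => i2 j2 /= rh; rewrite aM bM rM.
have -> : a ^+ i * b ^+ j * r ^+ h * (a ^+ i' * b ^+ j' * r ^+ h')
        = a ^+ i * b ^+ j * (r ^+ h * a ^+ i' * b ^+ j') * r ^+ h'.
  by rewrite !mulgA.
rewrite rh -!mulgA; congr (_ * _); rewrite !mulgA.
by congr (_ * _ * _ * _); apply: commuteX2.
Qed.

Lemma dih_map_alpha : dih_map a b r (dih_alpha n) = a.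
Proof. by rewrite /dih_map /= !mulg1. Qed.

Lemma dih_map_beta : dih_map a b r (dih_beta n) = b.
Proof.
by rewrite /dih_map /= mul1g mulg1 modn_small ?expg1.
Qed.

Lemma dih_map_rho : dih_map a b r (dih_rho n) = r.
Proof. by rewrite /dih_map /= !mul1g. Qed.

Lemma word_dih_map (i j : int) (e : bool) :
  exists x : dih n, dih_map a b r x = a ^z i * b ^z j * r ^+ e.
Proof.
exists ((dih_alpha n) ^z i * (dih_beta n) ^z j * (dih_rho n) ^+ e).
rewrite !dih_mapM !(gmorph_gz dih_mapM) dih_map_alpha dih_map_beta.
by case: e; rewrite ?expg1 ?dih_map_rho // (gmorph1 dih_mapM).
Qed.

(** In terms of normal forms: injectivity only has to be tested on the words
a^i b^j r^e with integer exponents, which is how elements of Out(E) arise. *)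
Lemma dih_map_inj :
  (forall i j e, a ^z i * b ^z j * r ^+ (e : bool) = 1 ->
     [/\ (2 %| i)%Z, (k %| j)%Z & e = false]) ->
  injective (@dih_map G n a b r).
Proof.
move=> free; apply: (gmorph_inj dih_mapM) => -[[i j] h] /=.
have hE : (h : nat) = (h == 1%R) :> nat by case: h => [[|[|[]]]].
rewrite /dih_map /= hE => /(free (Posz i) (Posz j)) [i2 j2 /negbT h1].
rewrite /dvdz /= in i2 j2.
have jn : (j < n)%N by rewrite -[X in (_ < X)%N](Zp_cast k1).
have -> : i = 1%g by case: i i2 => [[|[|[]]]] //= ? _; apply: val_inj.
have -> : h = 1%g by case: h h1 {hE} => [[|[|[]]]] //= ? _; apply: val_inj.
suff -> : j = 1%g by [].
apply: val_inj => /=; apply/eqP; rewrite -[_ == _]negbK -lt0n.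
by apply/negP => /dvdn_leq/(_ j2); rewrite leqNgt jn.
Qed.

Lemma dih_map_word (x : dih n) : exists (i j : int) (e : bool),
  dih_map a b r x = a ^z i * b ^z j * r ^+ e.
Proof.
case: x => [[i j] h]; exists (Posz i), (Posz j), (h == 1%R).
by rewrite /dih_map /=; case: h => [[|[|[]]]].
Qed.

End DihedralRecognition.

Lemma dih_map_comp (G H : groupType) (n : nat) (a b r : G) (f : G -> H) :
  {morph f : x y / x * y} ->
  forall x : dih n, f (dih_map a b r x) = dih_map (f a) (f b) (f r) x.
Proof.
move=> fM x; rewrite /dih_map !fM.
by congr (_ * _ * _); apply: (@gmorph_gz _ _ f fM (Posz _)).
Qed.

Definition out_val (G : Type) (a b r : G) (g : out_gen) : G :=
  match g with galpha => a | gbeta => b | grho => r end.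

(** Proves that a pair belongs to an explicitly enumerated set of relations, that is,
to a left-nested union of singletons. *)
Ltac in_rels := solve [repeat first [done | by right | left]].

Lemma out_rels_dih (G : groupType) (k : int) (x : out_gen -> G) :
  satisfies (out_rels k) x <-> dih_relations k (x galpha) (x gbeta) (x grho).
Proof.
split=> [xR | [a2 bk r2 [ab ra rb]] s t].
  have rel s t : out_rels k (s, t) -> geval x s = geval x t := @xR s t.
  pose al := TVar galpha; pose be := TVar gbeta; pose rh := TVar grho.
  split; first by apply: (rel (al * al)%gt 1%gt); in_rels.
  - by rewrite -(geval_tpow x be); apply: (rel _ 1%gt); in_rels.
  - by apply: (rel (rh * rh)%gt 1%gt); in_rels.
  split; first by apply: (rel (al * be)%gt (be * al)%gt); in_rels.
  - by apply: (rel (rh * al * rh)%gt al); in_rels.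
  by apply: (rel (rh * be * rh)%gt (be^-1)%gt); in_rels.
by move=> [[[[[]|]|]|]|] [-> ->] //=; rewrite geval_tpow.
Qed.

Definition dih_free (G : groupType) (k : int) (a b r : G) :=
  forall (i j : int) (e : bool), a ^z i * b ^z j * r ^+ e = 1 ->
  [/\ (2 %| i)%Z, (k %| j)%Z & e = false].

(** Both identifications come from one map. The semidirect product N maps onto the
presented group, since it hits the generators, and the composite N -> P -> G is
dih_map, which is bijective; so N -> P is injective as well, and P -> G is
bijective. *)
Theorem dihedral_presentation (G : groupType) (k : int) (a b r : G) :
  1 < `|k|%N -> dih_relations k a b r -> dih_free k a b r ->
  (forall g, exists (i j : int) (e : bool), g = a ^z i * b ^z j * r ^+ e) ->
  isomorphic G (presented (out_rels k)) /\ isomorphic G (dih `|k|%N).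
Proof.
move=> k1 rel free gen; set P := presented (out_rels k).
have FM := dih_mapM k1 rel; have FI := dih_map_inj k1 rel free.
have FS g : exists x, dih_map (n := `|k|%N) a b r x = g.
  by have [i [j [e ->]]] := gen g; apply: word_dih_map.
split; last exact/isomorphic_sym/(gmorph_isomorphic FM)/inj_surj_bij.
have Prel := (out_rels_dih k _).1 (@pgen_satisfies _ (out_rels k)).
have F'M := dih_mapM k1 Prel.
have F'S : forall y : P, exists x,
    dih_map (n := `|k|%N) (pgen _ galpha) (pgen _ gbeta) (pgen _ grho) x = y.
  apply: presented_ind => [[]||_ _ [x <-] [y <-]|_ [x <-]].
  - by exists (dih_alpha _); apply: dih_map_alpha.
  - by exists (dih_beta _); apply: dih_map_beta.
  - by exists (dih_rho _); apply: dih_map_rho.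
  - by exists 1; apply: gmorph1.
  - by exists (x * y); apply: F'M.
  - by exists x^-1; apply: gmorphV.
have [|phi phiE] := @presented_lift _ (out_rels k) G (out_val a b r).
  exact/out_rels_dih.
have phiF x : phi (dih_map (pgen _ galpha) (pgen _ gbeta) (pgen _ grho) x) = dih_map a b r x.
  by rewrite (dih_map_comp _ _ _ gmulfM) !phiE.
apply/isomorphic_sym; exists phi; apply: inj_surj_bij => [|g].
  by move=> x y; have [x' <-] := F'S x; have [y' <-] := F'S y; rewrite !phiF => /FI ->.
by have [x <-] := FS g; eexists; apply: phiF.
Qed.

(** * Groups with a subgroup of index two *)

Section SemidirectFacts.

Variables (N H : groupType) (act : {multiplicative H -> autom N}).

Lemma sd_conj (h : H) (x : N) :
  sd_inr act h * sd_inl act x * (sd_inr act h)^-1 = sd_inl act (act h x).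
Proof.
apply: (mulIg (sd_inr act h)); rewrite mulgVK.
rewrite [LHS](_ : _ = Defs.SdPair act (1 * act h x) (h * 1)) //.
rewrite [RHS](_ : _ = Defs.SdPair act (act h x * act 1 1) (1 * h)) //.
by rewrite Defs.act_1 mulg1 !mul1g mulg1.
Qed.

End SemidirectFacts.

Section IndexTwo.

Variables (N G : groupType) (f : N -> G) (w : G).
Hypotheses (fM : {morph f : x y / x * y}) (fI : injective f).
Hypothesis wJ : forall x, exists y, w * f x * w^-1 = f y.
Hypothesis wNf : forall x, f x <> w.
Hypothesis cover : forall g, exists x, g = f x \/ g = f x * w.

(** The complement is the group of order two generated by w, and the action is
conjugation by w pulled back along the injection f. Only conjugation inside G has
to be understood: that the action is by automorphisms of N is then automatic. *)
Lemma split_extension : w * w = 1 ->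
  exists act : {multiplicative ('Z_2 : groupType) -> autom N},
    (forall x, f (act (1%R : 'Z_2) x) = w * f x * w^-1) /\
    isomorphic G (semidirect_group act).
Proof.
move=> w2; have wV : w^-1 = w by apply: mulg1_eq.
pose c x := projT1 (cid (wJ x)).
have cE x : f (c x) = w * f x * w^-1 by rewrite /c; case: cid.
have cK : involutive c.
  by move=> x; apply: fI; rewrite !cE wV !mulgA w2 mul1g -mulgA w2 mulg1.
have cM : {morph c : x y / x * y}.
  by move=> x y; apply: fI; rewrite fM !cE fM !mulgA mulgVK.
pose C : autom N := Autom cM (inv_bij cK).
have C2 : C ^+ 2 = 1 by apply: automP => x; apply: cK.
have [act actE] := exists_morphism (expg_Zp (n := 2) isT C2).
exists act; split=> [x|]; first by rewrite actE -cE.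
pose F (x : semidirect_group act) : G := f (sd_fst x) * w ^+ sd_snd x.
have FM : {morph F : x y / x * y}.
  move=> [x h] [y h']; rewrite /F /= (expg_Zp (n := 2) isT (w2 : w ^+ 2 = 1)).
  rewrite fM actE !mulgA; congr (_ * _); rewrite -!mulgA; congr (_ * _).
  case: h => [[|[|//]]] hh /=; rewrite ?mulg1 ?mul1g //.
  by rewrite !expg1 cE mulgVK.
apply/isomorphic_sym/(gmorph_isomorphic FM)/inj_surj_bij => [|g].
  apply: (gmorph_inj FM) => -[x h]; rewrite /F /= => xh.
  have h1 : h = 1.
    case: h xh => [[|[|//]]] hh /= xw; apply: val_inj => //=.
    by case: (@wNf x^-1); rewrite (gmorphV fM); apply: mulg1_eq.
  move: xh; rewrite h1 mulg1 -(gmorph1 fM) => /fI ->.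
  by [].
have [x [->|->]] := cover g; first by exists (Defs.SdPair act x 1); rewrite /F /= mulg1.
by exists (Defs.SdPair act x 1%R); rewrite /F /= expg1.
Qed.

(** The projection sends f N to the neutral element and the other coset to the
generator; it is multiplicative because w normalizes f N and w^2 lies in f N. *)
Lemma index_two_exact : (exists z, w * w = f z) ->
  exists (i : {multiplicative N -> G}) (p : {multiplicative G -> ('Z_2 : groupType)}),
    i =1 f /\ short_exact i p.
Proof.
move=> [z w2]; pose P g := exists x, f x = g.
have PM g h : P g -> P h -> P (g * h).
  by move=> [x <-] [y <-]; exists (x * y).
have PV g : P g -> P g^-1 by move=> [x <-]; exists x^-1; apply: gmorphV.
have PMl g h : P g -> P (g * h) -> P h.
  by move=> Pg Pgh; rewrite -(mulKg g h); apply: PM => //; apply: PV.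
have PMr g h : P h -> P (g * h) -> P g.
  by move=> Ph Pgh; rewrite -(mulgK h g); apply: PM => //; apply: PV.
have PN g h : ~ P g -> ~ P h -> P (g * h).
  move=> Ng Nh; have [x gE] := cover g; have [y hE] := cover h.
  case: gE => gE; first by case: Ng; exists x.
  case: hE => hE; first by case: Nh; exists y.
  have [y' y'E] := wJ y.
  rewrite gE hE (_ : _ * _ = f x * (w * f y * w^-1) * (w * w)).
    by exists (x * y' * z); rewrite !fM y'E w2.
  by rewrite !mulgA mulgVK.
pose p0 g : 'Z_2 := if `[< P g >] then 1%g else (1%R : 'Z_2).
have p01 g : p0 g = 1 <-> P g.
  by rewrite /p0; split; [case: asboolP | move/asboolP ->].
have p0M : {morph p0 : x y / x * y}.
  move=> g h; rewrite /p0.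
  case: (asboolP (P g)) => Pg; case: (asboolP (P h)) => Ph.
  - by rewrite asboolT ?mulg1 //; apply: PM.
  - by rewrite asboolF ?mul1g // => Pgh; apply/Ph/(PMl g).
  - by rewrite asboolF ?mulg1 // => Pgh; apply/Pg/(PMr _ h).
  - by rewrite asboolT; [apply: val_inj | apply: PN].
have [i iE] := exists_morphism fM; have [p pE] := exists_morphism p0M.
exists i, p; split=> //; split=> [x y|g|q].
- by rewrite !iE; apply: fI.
- by rewrite pE p01 /P; split=> -[x xg]; exists x; rewrite -xg iE.
case: (eqVneq q 1%R) => [->|q1].
  by exists w; rewrite pE /p0 asboolF // => -[x /wNf].
exists 1; rewrite pE /p0 asboolT; last by exists 1; apply: gmorph1.
by case: q q1 => [[|[|//]]] //= ? _; apply: val_inj.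
Qed.

End IndexTwo.

(** Normalizing the image of dih_map is a condition on the three generators only,
because conjugation by w is multiplicative. *)
Lemma dih_map_normalized (G : groupType) (k : int) (a b r w : G) :
  1 < `|k|%N -> dih_relations k a b r ->
  let f := dih_map (n := `|k|%N) a b r in
  (exists x, w * a * w^-1 = f x) -> (exists x, w * b * w^-1 = f x) ->
  (exists x, w * r * w^-1 = f x) -> forall x, exists y, w * f x * w^-1 = f y.
Proof.
move=> k1 rel f [xa xaE] [xb xbE] [xr xrE] x.
have fM : {morph f : x y / x * y} := dih_mapM k1 rel.
have wM : {morph (fun g => w * g * w^-1) : g h / g * h}.
  by move=> g h /=; rewrite !mulgA mulgVK.
exists (dih_map xa xb xr x).
by rewrite (dih_map_comp _ _ _ fM) -xaE -xbE -xrE [LHS](dih_map_comp _ _ _ wM).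
Qed.

Lemma out4_relsP (G : groupType) (r s t : int) (x : out4_gen -> G) :
  let a := x halpha in let b := x hbeta in let c := x hrho in let w := x homega in
  satisfies (out4_rels r s t) x <->
  [/\ dih_relations (2 * t)%R a b c, w * w = b ^z t * c,
      w * a * w^-1 = a ^z r * b ^z (s * t)%R,
      w * b * w^-1 = a * b ^z r
    & w * c * w^-1 = a ^z t * b ^z (t * (r + 1))%R * c].
Proof.
move=> a b c w; split=> [xR | [[a2 bk c2 [ab ca cb]] w2 wa wb wc] y z].
  have rel y z : out4_rels r s t (y, z) -> geval x y = geval x z := @xR y z.
  pose al := TVar halpha; pose be := TVar hbeta.
  pose rh := TVar hrho; pose om := TVar homega.
  split; first split.
  - by apply: (rel (al * al)%gt 1%gt); in_rels.
  - by rewrite -(geval_tpow x be); apply: (rel _ 1%gt); in_rels.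
  - by apply: (rel (rh * rh)%gt 1%gt); in_rels.
  - split; first by apply: (rel (al * be)%gt (be * al)%gt); in_rels.
    + by apply: (rel (rh * al * rh)%gt al); in_rels.
    by apply: (rel (rh * be * rh)%gt (be^-1)%gt); in_rels.
  - by rewrite -(geval_tpow x be); apply: (rel (om * om)%gt (be ^z t * rh)%gt); in_rels.
  - rewrite -(geval_tpow x al) -(geval_tpow x be).
    by apply: (rel (om * al * om^-1)%gt (al ^z r * be ^z (s * t)%R)%gt); in_rels.
  - rewrite -(geval_tpow x be).
    by apply: (rel (om * be * om^-1)%gt (al * be ^z r)%gt); in_rels.
  rewrite -(geval_tpow x al) -(geval_tpow x be).
  by apply: (rel (om * rh * om^-1)%gt (al ^z t * be ^z (t * (r + 1))%R * rh)%gt); in_rels.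
by move=> [[[[[[[[[]|]|]|]|]|]|]|]|] [-> ->] //=; rewrite !geval_tpow.
Qed.

(** The relations show that in the presented group P the image g N of the dihedral
group has at most two cosets, g N and g N w. On g N the map P -> G is injective
because it restricts to the injective f, and the coset g N w cannot meet the
kernel because w is not in f N. Thus a faithful dihedral subgroup of index two in
G is enough for the presentation. *)
Theorem out4_presentation (G : groupType) (r s t : int) (x : out4_gen -> G) :
  let f := dih_map (n := `|(2 * t)%R|%N) (x halpha) (x hbeta) (x hrho) in
  1 < `|(2 * t)%R|%N -> satisfies (out4_rels r s t) x -> injective f ->
  (forall y, f y <> x homega) ->
  (forall g, exists y, g = f y \/ g = f y * x homega) ->
  presents (out4_rels r s t) x.
Proof.
move=> f k1 xR fI wNf cover; set R := out4_rels r s t.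
have [phi phiE] := presented_lift xR; exists phi; split=> //.
have [rel w2 wa wb wc] := (out4_relsP r s t x).1 xR.
have [Prel Pw2 Pwa Pwb Pwc] := (out4_relsP r s t _).1 (@pgen_satisfies _ R).
have fM : {morph f : y z / y * z} := dih_mapM k1 rel.
pose g := dih_map (n := `|(2 * t)%R|%N) (pgen R halpha) (pgen R hbeta) (pgen R hrho).
pose w := pgen R homega.
have gM : {morph g : y z / y * z} := dih_mapM k1 Prel.
have phig y : phi (g y) = f y by rewrite (dih_map_comp _ _ _ gmulfM) !phiE.
have gP (i j : int) (e : bool) : exists y,
    pgen R halpha ^z i * pgen R hbeta ^z j * pgen R hrho ^+ e = g y.
  by have [y yE] := word_dih_map k1 Prel i j e; exists y.
have wJ : forall y, exists z, w * g y * w^-1 = g z.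
  apply: dih_map_normalized => //.
  - by have [z zE] := gP r (s * t)%R false; exists z; rewrite Pwa -[RHS]/(g z) -zE mulg1.
  - by have [z zE] := gP 1%R r false; exists z; rewrite Pwb -[RHS]/(g z) -zE mulg1.
  - by have [z zE] := gP t (t * (r + 1))%R true; exists z; rewrite Pwc -[RHS]/(g z) -zE expg1.
have [u uE] : exists u, w * w = g u.
  by have [u uE] := gP 0%R t true; exists u; rewrite Pw2 -uE mul1g expg1.
(* The union of the two cosets contains the generators and is a subgroup. *)
have gS : forall p, exists y, p = g y \/ p = g y * w.
  apply: presented_ind => [[]||p q [y yE] [z zE]|p [y yE]].
  - by exists (dih_alpha _); left; rewrite /g dih_map_alpha.
  - by exists (dih_beta _); left; rewrite /g dih_map_beta.
  - by exists (dih_rho _); left; rewrite /g dih_map_rho.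
  - by exists 1; right; rewrite (gmorph1 gM) mul1g.
  - by exists 1; left; rewrite (gmorph1 gM).
  - case: yE zE => -> [] ->.
    + by exists (y * z); left; rewrite gM.
    + by exists (y * z); right; rewrite gM mulgA.
    + have [z' z'E] := wJ z; exists (y * z'); right.
      by rewrite gM -z'E !mulgA mulgVK.
    have [z' z'E] := wJ z; exists (y * z' * u); left.
    by rewrite !gM -z'E -uE !mulgA mulgVK.
  case: yE => ->; first by exists y^-1; left; rewrite (gmorphV gM).
  have [z zE] := wJ y^-1; exists (u^-1 * z); right.
  by rewrite gM (gmorphV gM) -zE -uE (invgM w w) (invgM (g y) w) (gmorphV gM) !mulgA !mulgVK.
apply: inj_surj_bij => [|h].
  apply: (gmorph_inj gmulfM) => p; have [y [->|->]] := gS p.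
    by rewrite phig -(gmorph1 fM) => /fI ->; rewrite (gmorph1 gM).
  rewrite gmulfM phig phiE => yw; case: (@wNf y^-1).
  by rewrite (gmorphV fM); apply: mulg1_eq.
have [y [->|->]] := cover h; first by exists (g y).
by exists (g y * w); rewrite gmulfM phig phiE.
Qed.

(** * The group of bijections of a type *)

Section Bijections.

(** The inverse is a field so that products and inverses compute; it is determined
by the map, hence equality is pointwise equality of the maps. *)
Record bijection (X : Type) := Bijection {
  bij_fun :> X -> X;
  bij_inv : X -> X;
  bij_funK : cancel bij_fun bij_inv;
  bij_invK : cancel bij_inv bij_fun }.

HB.instance Definition _ X := gen_eqMixin (bijection X).
HB.instance Definition _ X := gen_choiceMixin (bijection X).

Variable X : Type.

Lemma bijectionP (f g : bijection X) : f =1 g -> f = g.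
Proof.
move=> fg; have fg' : bij_inv f =1 bij_inv g.
  by move=> x; rewrite -{1}(bij_invK g x) -fg bij_funK.
case: f g fg fg' => f f' fK Kf [g g' gK Kg] /= /funext fg /funext fg'.
case: _ / fg in gK Kg *; case: _ / fg' in gK Kg *.
by congr Bijection; apply: Prop_irrelevance.
Qed.

Definition bijection_one : bijection X :=
  @Bijection X id id (fun=> erefl) (fun=> erefl).
Definition bijection_mul (f g : bijection X) : bijection X :=
  Bijection (can_comp (bij_funK f) (bij_funK g)) (can_comp (bij_invK g) (bij_invK f)).
Definition bijection_inv (f : bijection X) : bijection X :=
  Bijection (bij_invK f) (bij_funK f).

Lemma bijection_mulA : associative bijection_mul.
Proof. by move=> f g h; apply: bijectionP. Qed.
Lemma bijection_mul1 : left_id bijection_one bijection_mul.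
Proof. by move=> f; apply: bijectionP. Qed.
Lemma bijection_1mul : right_id bijection_one bijection_mul.
Proof. by move=> f; apply: bijectionP. Qed.
Lemma bijection_mulV : left_inverse bijection_one bijection_inv bijection_mul.
Proof. by move=> f; apply: bijectionP => x; apply: bij_funK. Qed.
Lemma bijection_Vmul : right_inverse bijection_one bijection_inv bijection_mul.
Proof. by move=> f; apply: bijectionP => x; apply: bij_invK. Qed.

HB.instance Definition _ := isGroup.Build (bijection X)
  bijection_mulA bijection_mul1 bijection_1mul bijection_mulV bijection_Vmul.

End Bijections.

(** * Computing in the sapphire group *)

(** The element d^x b^y. It is locked because unification would otherwise unfold it
as a product when reassociating words. *)
HB.lock Definition trans (B : 'M[int]_2) (x y : int) : sapphire B :=
  sap_d B ^z x * sap_b B ^z y.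

Section SapphireGroup.

Variables r s t u : int.
Hypothesis det : (r * u - s * t = 1)%R.
Local Notation B := (mx22 r s t u).
Local Notation E := (sapphire B).
Local Notation d := (sap_d B).
Local Notation b := (sap_b B).
Local Notation v := (sap_v B).
Local Notation a := (sap_a B).
Local Notation T := (trans B).
Local Notation m := (r * u + s * t)%R.

Lemma mx22E (p q p' q' : int) (M := mx22 p q p' q') :
  [/\ M 0%R 0%R = p, M 0%R 1%R = q, M 1%R 0%R = p' & M 1%R 1%R = q'].
Proof. by rewrite /M !mxE. Qed.

Definition sap_val (G : Type) (D b0 V A : G) (g : sapphire_gen) : G :=
  match g with gd => D | gb => b0 | gv => V | ga => A end.

(** The defining relations of the sapphire group of the matrix with rows (r, s) and
(t, u), with the entries of theta computed; m is the common diagonal entry. *)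
Definition sap_relations (G : groupType) (D b0 V A : G) :=
  [/\ D * b0 = b0 * D,
      V * D * V^-1 = D ^z m * b0 ^z (- (2 * s * u))%R,
      V * b0 * V^-1 = D ^z (- (2 * r * t))%R * b0 ^z m
    & [/\ A * A = D, A * b0 = b0^-1 * A
      & A * V * A^-1 = D ^z (r - r * u - s * t)%R * b0 ^z (s - 2 * s * u)%R * V^-1]].

Lemma sap_relsP (G : groupType) (x : sapphire_gen -> G) :
  satisfies (sapphire_rels B) x <-> sap_relations (x gd) (x gb) (x gv) (x ga).
Proof.
have [B11 B12 B21 B22] := mx22E r s t u.
have [t11 t12 t21 t22] := mx22E m (- (2 * r * t))%R (- (2 * s * u))%R m.
have tE : theta B = mx22 m (- (2 * r * t))%R (- (2 * s * u))%R m.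
  by rewrite /theta B11 B12 B21 B22.
split=> [xR | [db vd vb [aa ab av]] y z].
  have rel y z : sapphire_rels B (y, z) -> geval x y = geval x z := @xR y z.
  pose D := TVar gd; pose b0 := TVar gb; pose V := TVar gv; pose A := TVar ga.
  rewrite /sapphire_rels tE t11 t12 t21 t22 B11 B12 B21 B22 in rel.
  split.
  - by apply: (rel (D * b0)%gt (b0 * D)%gt); in_rels.
  - rewrite -(geval_tpow x D) -(geval_tpow x b0).
    by apply: (rel (V * D * V^-1)%gt (_ * _)%gt); in_rels.
  - rewrite -(geval_tpow x D) -(geval_tpow x b0).
    by apply: (rel (V * b0 * V^-1)%gt (_ * _)%gt); in_rels.
  split; first by apply: (rel (A * A)%gt D); in_rels.
  - by apply: (rel (A * b0)%gt (b0^-1 * A)%gt); in_rels.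
  rewrite -(geval_tpow x D) -(geval_tpow x b0).
  by apply: (rel (A * V * A^-1)%gt (_ * _ * V^-1)%gt); in_rels.
rewrite /sapphire_rels tE t11 t12 t21 t22 B11 B12 B21 B22.
by move=> [[[[[]|]|]|]|] [-> ->] //=; rewrite !geval_tpow.
Qed.

Lemma sap_lift (G : groupType) (D b0 V A : G) : sap_relations D b0 V A ->
  exists f : {multiplicative E -> G}, [/\ f d = D, f b = b0, f v = V & f a = A].
Proof.
move=> rel; have [|f fE] := @presented_lift _ (sapphire_rels B) G (sap_val D b0 V A).
  exact/sap_relsP.
by exists f; split; apply: fE.
Qed.

Lemma sap_rels : sap_relations d b v a.
Proof. exact: ((sap_relsP (pgen (sapphire_rels B))).1 (@pgen_satisfies _ _)). Qed.

Lemma transE x y : T x y = d ^z x * b ^z y. Proof. by rewrite trans.unlock. Qed.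
Lemma trans_d : T 1 0 = d. Proof. by rewrite trans.unlock mulg1. Qed.
Lemma trans_b : T 0 1 = b. Proof. by rewrite trans.unlock mul1g. Qed.
Lemma trans0 : T 0 0 = 1. Proof. by rewrite trans.unlock mulg1. Qed.

Lemma transD x y x' y' : T x y * T x' y' = T (x + x')%R (y + y')%R.
Proof.
have [db _ _ _] := sap_rels.
have c : commute (d ^z x') (b ^z y) by apply/commutez/commute_sym/commutez.
by rewrite trans.unlock !expgzD -!mulgA; congr (_ * _); rewrite !mulgA c.
Qed.

Lemma transV x y : (T x y)^-1 = T (- x)%R (- y)%R.
Proof. by apply: mulg1_eq; rewrite transD !GRing.subrr trans0. Qed.

Lemma transz x y n : T x y ^z n = T (n * x)%R (n * y)%R.
Proof.
rewrite (@additive_expgz _ (fun n => T (n * x)%R (n * y)%R)) ?GRing.mul1r //.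
by move=> i j; rewrite transD !GRing.mulrDl.
Qed.

Lemma morph_trans (G : groupType) (f : E -> G) x y : {morph f : g h / g * h} ->
  f (T x y) = f d ^z x * f b ^z y.
Proof. by move=> fM; rewrite trans.unlock fM !(gmorph_gz fM). Qed.

(** An endomorphism that sends d and b into <d, b> acts there by the matrix with
columns f d and f b. *)
Lemma morph_trans_lin (f : E -> E) p q p' q' x y : {morph f : g h / g * h} ->
  f d = T p q -> f b = T p' q' ->
  f (T x y) = T (p * x + p' * y)%R (q * x + q' * y)%R.
Proof.
move=> fM fd fb; rewrite morph_trans // fd fb !transz transD.
by rewrite (GRing.mulrC p) (GRing.mulrC p') (GRing.mulrC q) (GRing.mulrC q').
Qed.

Lemma v_trans x y : v * T x y = T (m * x - 2 * r * t * y)%R (m * y - 2 * s * u * x)%R * v.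
Proof.
have [_ vd vb _] := sap_rels; rewrite -!transE in vd vb.
have fM : {morph (fun g => v * g * v^-1) : g h / g * h}.
  by move=> g h /=; rewrite !mulgA mulgVK.
have h : v * T x y * v^-1 = _ := morph_trans_lin x y fM vd vb.
rewrite -[LHS](mulgVK v) h.
by congr (T _ _ * _); ring.
Qed.

(** This is det theta = 1. *)
Lemma half_trace_sq : (m * m = 1 + 4 * (r * s * t * u))%R.
Proof.
have -> : (m * m = (r * u - s * t) * (r * u - s * t) + 4 * (r * s * t * u))%R by ring.
by rewrite det.
Qed.

(** The matrix is the inverse of theta, which is theta with its off-diagonal entries
negated. *)
Lemma vV_trans x y :
  v^-1 * T x y = T (m * x + 2 * r * t * y)%R (m * y + 2 * s * u * x)%R * v^-1.
Proof.
apply: (mulgI v); rewrite mulgA mulgV mul1g mulgA v_trans mulgK.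
have mm := half_trace_sq.
congr T.
  transitivity ((m * m - 4 * (r * s * t * u)) * x)%R; last by ring.
  by rewrite mm; ring.
transitivity ((m * m - 4 * (r * s * t * u)) * y)%R; last by ring.
by rewrite mm; ring.
Qed.

Lemma a_trans x y : a * T x y = T x (- y)%R * a.
Proof.
have [_ _ _ [aa ab _]] := sap_rels.
have fM : {morph (fun g => a * g * a^-1) : g h / g * h}.
  by move=> g h /=; rewrite !mulgA mulgVK.
have ad : a * d * a^-1 = T 1 0 by rewrite -aa mulgA mulgK trans_d.
have ab' : a * b * a^-1 = T 0 (-1)%R by rewrite ab mulgK -trans_b transV.
have h : a * T x y * a^-1 = _ := morph_trans_lin x y fM ad ab'.
rewrite -[LHS](mulgVK a) h.
by congr (T _ _ * _); ring.
Qed.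

Lemma aa_trans : a * a = T 1 0.
Proof. by have [_ _ _ [-> _ _]] := sap_rels; rewrite trans_d. Qed.

Lemma aV_trans : a^-1 = T (-1)%R 0 * a.
Proof. by apply: mulg1_eq; rewrite mulgA a_trans -mulgA aa_trans transD trans0. Qed.

Lemma a_v : a * v = T (r - r * u - s * t)%R (s - 2 * s * u)%R * (v^-1 * a).
Proof. by have [_ _ _ [_ _ av]] := sap_rels; rewrite transE mulgA -av mulgVK. Qed.

(** Together with v_trans, vV_trans, a_trans, aa_trans and a_v this rule moves all
translations to the left of a word; it is equivalent to a_v. *)
Lemma a_vV : a * v^-1 = T (1 - r)%R s * (v * a).
Proof.
apply: (mulIg v); rewrite mulgVK -!mulgA a_v (mulgA v) v_trans -mulgA mulVKg.
rewrite mulgA transD -[LHS]mul1g; congr (_ * _); rewrite -trans0.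
congr T; apply/esym.
  transitivity (1 - r + r * (r * u - s * t) - (m * m - 4 * (r * s * t * u)))%R; first by ring.
  by rewrite half_trace_sq det; ring.
transitivity (s - s * (r * u - s * t))%R; first by ring.
by rewrite det; ring.
Qed.

End SapphireGroup.

Definition int_shift (k : int) : bijection int :=
  Bijection (GRing.addrK k : cancel (fun x => x + k)%R (fun x => x - k)%R) (GRing.subrK k).

Definition int_flip : bijection int :=
  Bijection (@GRing.opprK int) (@GRing.opprK int).

Lemma int_shiftz k : int_shift k = int_shift 1 ^z k.
Proof.
apply: additive_expgz => i j; apply: bijectionP => x.
by rewrite [LHS]/= (GRing.addrC i) GRing.addrA.
Qed.

(** * Two actions of the sapphire group and its normal form *)

Section SapphireAction.

Variables r s t u : int.
Hypothesis det : (r * u - s * t = 1)%R.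
Local Notation B := (mx22 r s t u).
Local Notation E := (sapphire B).
Local Notation d := (sap_d B).
Local Notation b := (sap_b B).
Local Notation v := (sap_v B).
Local Notation a := (sap_a B).
Local Notation T := (trans B).
Local Notation m := (r * u + s * t)%R.

(** The quotient of E by <d, b> is infinite dihedral. It is realized on the integers,
v acting as the unit translation and a as the reflection at 0. *)
Lemma height_exists : exists f : {multiplicative E -> bijection int},
  [/\ f d = 1, f b = 1, f v = int_shift 1 & f a = int_flip].
Proof.
apply: sap_lift; have e1 n : (1 : bijection int) ^z n = 1.
  by case: n => n; rewrite /= expg1n ?invg1.
split; rewrite ?e1 ?mulg1 ?mul1g ?mulgV //.
split; rewrite ?mulg1 ?invg1 ?mul1g //; apply: bijectionP => x.
by apply: (@etrans _ _ (- (- x + 1))%R) => //; rewrite GRing.opprD GRing.opprK.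
Qed.

Definition height := projT1 (cid height_exists).

Lemma heightE : [/\ height d = 1, height b = 1, height v = int_shift 1 & height a = int_flip].
Proof. by rewrite /height; case: cid. Qed.

Lemma heightM : {morph height : g h / g * h}.
Proof. exact: gmulfM. Qed.

Lemma height_trans x y : height (T x y) = 1.
Proof.
have [hd hb _ _] := heightE; rewrite transE heightM !(gmorph_gz heightM) hd hb.
have e1 n : (1 : bijection int) ^z n = 1.
  by case: n => n; rewrite /= expg1n ?invg1.
by rewrite !e1 mulg1.
Qed.

Lemma height_v k : height (v ^z k) = int_shift k.
Proof. by have [_ _ hv _] := heightE; rewrite (gmorph_gz heightM) hv -int_shiftz. Qed.

Lemma height_a (e : bool) : height (a ^+ e) = if e then int_flip else 1.
Proof. by have [_ _ _ ha] := heightE; case: e; rewrite ?expg1 // (gmorph1 heightM). Qed.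

(** The next three bijections describe the affine action of E on R^2 x R defining
its Sol geometry, restricted to a lattice: d, b and v act by translation and theta
on the plane, a by the half translation e1 / 2 composed with diag(1, -1), the line
coordinate being the height. Plane coordinates are doubled, to make them
integers. *)
Definition plane_shift (x y : int) : bijection (int * int * int).
Proof.
exists (fun z => (z.1.1 + 2 * x, z.1.2 + 2 * y, z.2)%R)
       (fun z => (z.1.1 - 2 * x, z.1.2 - 2 * y, z.2)%R).
- by move=> [[z1 z2] h] /=; rewrite !GRing.addrK.
- by move=> [[z1 z2] h] /=; rewrite !GRing.subrK.
Defined.

Definition affine_v : bijection (int * int * int).
Proof.
(* The translation part (r - 1, - s) is the one for which the relation between
     a v a^-1 and v^-1 holds. *)
exists (fun z => (m * z.1.1 - 2 * r * t * z.1.2 + (r - 1),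
                  m * z.1.2 - 2 * s * u * z.1.1 - s, z.2 + 1)%R)
       (fun z => (m * (z.1.1 - (r - 1)) + 2 * r * t * (z.1.2 + s),
                  m * (z.1.2 + s) + 2 * s * u * (z.1.1 - (r - 1)), z.2 - 1)%R).
- move=> [[z1 z2] h] /=; rewrite !GRing.addrK !GRing.subrK; congr (_, _, _).
    by transitivity ((m * m - 4 * (r * s * t * u)) * z1)%R; [ring | rewrite half_trace_sq //; ring].
  by transitivity ((m * m - 4 * (r * s * t * u)) * z2)%R; [ring | rewrite half_trace_sq //; ring].
- move=> [[z1 z2] h] /=; rewrite !GRing.subrK; congr (_, _, _).
    transitivity ((m * m - 4 * (r * s * t * u)) * (z1 - (r - 1)) + (r - 1))%R; first by ring.
    by rewrite half_trace_sq //; ring.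
  transitivity ((m * m - 4 * (r * s * t * u)) * (z2 + s) - s)%R; first by ring.
  by rewrite half_trace_sq //; ring.
Defined.

Definition affine_a : bijection (int * int * int).
Proof.
exists (fun z => (z.1.1 + 1, - z.1.2, - z.2)%R) (fun z => (z.1.1 - 1, - z.1.2, - z.2)%R).
- by move=> [[z1 z2] h] /=; rewrite !GRing.addrK !GRing.opprK.
- by move=> [[z1 z2] h] /=; rewrite !GRing.subrK !GRing.opprK.
Defined.

Lemma plane_shift_d k : plane_shift 1 0 ^z k = plane_shift k 0.
Proof.
apply/esym/(@additive_expgz _ (plane_shift^~ 0%R)) => i j.
apply: bijectionP => -[[z1 z2] h].
by apply: (@etrans _ _ (z1 + 2 * j + 2 * i, z2 + 2 * 0 + 2 * 0, h)%R) => //=; congr (_, _, _); ring.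
Qed.

Lemma plane_shift_b k : plane_shift 0 1 ^z k = plane_shift 0 k.
Proof.
apply/esym/(@additive_expgz _ (plane_shift 0)) => i j.
apply: bijectionP => -[[z1 z2] h].
by apply: (@etrans _ _ (z1 + 2 * 0 + 2 * 0, z2 + 2 * j + 2 * i, h)%R) => //=; congr (_, _, _); ring.
Qed.

Lemma affine_action_exists : exists f : {multiplicative E -> bijection (int * int * int)},
  [/\ f d = plane_shift 1 0, f b = plane_shift 0 1, f v = affine_v & f a = affine_a].
Proof.
have mulE (X : Type) (f g : bijection X) x : (f * g) x = f (g x) by [].
have invE (X : Type) (f : bijection X) x : f^-1 x = bij_inv f x by [].
apply: sap_lift; split.
- apply: bijectionP => -[[z1 z2] h]; rewrite !mulE /=; congr (_, _, _); ring.
- apply: (mulIg affine_v); rewrite mulgVK plane_shift_d plane_shift_b.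
  apply: bijectionP => -[[z1 z2] h]; rewrite !mulE /=; congr (_, _, _); ring.
- apply: (mulIg affine_v); rewrite mulgVK plane_shift_d plane_shift_b.
  apply: bijectionP => -[[z1 z2] h]; rewrite !mulE /=; congr (_, _, _); ring.
split.
- apply: bijectionP => -[[z1 z2] h]; rewrite !mulE /=; congr (_, _, _); ring.
- apply: (mulgI (plane_shift 0 1)); rewrite !mulgA mulgV mul1g.
  apply: bijectionP => -[[z1 z2] h]; rewrite !mulE /=; congr (_, _, _); ring.
apply: (mulIg affine_a); rewrite mulgVK plane_shift_d plane_shift_b.
apply: bijectionP => -[[z1 z2] h]; rewrite !mulE invE /=; congr (_, _, _); last by ring.
  transitivity (m * z1 - 2 * r * t * z2 + (r - 1) + 1)%R; first by ring.
  apply/eqP; rewrite -GRing.subr_eq0; apply/eqP.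
  transitivity (r * ((r * u - s * t) - 1))%R; last by rewrite det; ring.
  ring.
transitivity (- (m * z2 - 2 * s * u * z1 - s))%R; first by ring.
apply/eqP; rewrite -GRing.subr_eq0; apply/eqP.
transitivity (s * ((r * u - s * t) - 1))%R; last by rewrite det; ring.
ring.
Qed.

(** The subgroup <d, b> is free abelian of rank two: it acts faithfully by
translations on the plane. *)
Lemma trans_eq1 x y : T x y = 1 -> x = 0%R /\ y = 0%R.
Proof.
have [f [fd fb _ _]] := affine_action_exists.
move=> /(congr1 f); rewrite transE (gmorph1 gmulfM) gmulfM !(gmorph_gz gmulfM).
rewrite fd fb plane_shift_d plane_shift_b.
move=> /(congr1 (fun g : bijection _ => g (0, 0, 0)%R)) => -[]; lia.
Qed.

Lemma trans_inj x y x' y' : T x y = T x' y' -> x = x' /\ y = y'.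
Proof.
move=> TT; have : T (x - x')%R (y - y')%R = 1 by rewrite -transD TT -transV mulgV.
by move=> /trans_eq1 [xx yy]; split; apply/eqP; rewrite -GRing.subr_eq0 ?xx ?yy.
Qed.

Lemma vz_trans k x y : exists x' y', v ^z k * T x y = T x' y' * v ^z k.
Proof.
elim/int_rect: k x y => [|k IHk|k IHk] x y; first by exists x, y; rewrite mulg1 mul1g.
  have -> : (k.+1%:Z = k%:Z + 1)%R by lia.
  have [x' [y' E']] := IHk (m * x - 2 * r * t * y)%R (m * y - 2 * s * u * x)%R.
  by exists x', y'; rewrite expgzSr -mulgA v_trans // mulgA E' mulgA.
have -> : (- k.+1%:Z = - k%:Z - 1)%R by lia.
have [x' [y' E']] := IHk (m * x + 2 * r * t * y)%R (m * y + 2 * s * u * x)%R.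
by exists x', y'; rewrite expgzBr -mulgA vV_trans // mulgA E' mulgA.
Qed.

Lemma a_vz k : exists x y, a * v ^z k = T x y * (v ^z (- k)%R * a).
Proof.
elim/int_rect: k => [|k [x [y IHk]]|k [x [y IHk]]].
- by exists 0%R, 0%R; rewrite trans0 mulg1 !mul1g.
- have -> : (k.+1%:Z = k%:Z + 1)%R by lia.
  rewrite expgzSr mulgA IHk -!mulgA a_v.
  have [x' [y' E']] := vz_trans (- k%:Z)%R (r - r * u - s * t)%R (s - 2 * s * u)%R.
  exists (x + x')%R, (y + y')%R; rewrite (mulgA (v ^z _)) E' -!mulgA mulgA transD.
  by congr (_ * _); rewrite mulgA -expgzBr; congr (v ^z _ * _); lia.
have -> : (- k.+1%:Z = - k%:Z - 1)%R by lia.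
rewrite expgzBr mulgA IHk -!mulgA a_vV //.
have [x' [y' E']] := vz_trans (- - k%:Z)%R (1 - r)%R s.
exists (x + x')%R, (y + y')%R; rewrite (mulgA (v ^z _)) E' -!mulgA mulgA transD.
by congr (_ * _); rewrite mulgA -expgzSr; congr (v ^z _ * _); lia.
Qed.

Definition sap_word (x y k : int) (e : bool) : E := T x y * (v ^z k * a ^+ e).

(** The words T x y v^k a^e contain the generators and are closed under product and
inverse, by moving translations to the left, using a v^k = T v^-k a and
a^2 = d. *)
Lemma normal_form g : exists x y k e, g = sap_word x y k e.
Proof.
pose N g := exists x y k e, g = sap_word x y k e.
have NT x y h : N h -> N (T x y * h).
  by move=> [x' [y' [k [e ->]]]]; exists (x + x')%R, (y + y')%R, k, e;
     rewrite /sap_word mulgA transD.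
have Nv k h : N h -> N (v ^z k * h).
  move=> [x [y [l [e ->]]]]; have [x' [y' E']] := vz_trans k x y.
  by exists x', y', (k + l)%R, e; rewrite /sap_word mulgA E' expgzD !mulgA.
have N1 : N 1 by exists 0%R, 0%R, 0%R, false; rewrite /sap_word trans0 !mul1g.
have NT1 x y : N (T x y) by rewrite -[T x y]mulg1; apply/NT.
have Na h : N h -> N (a * h).
  move=> [x [y [k [e ->]]]]; rewrite /sap_word mulgA a_trans -mulgA; apply/NT.
  have [x' [y' E']] := a_vz k; rewrite mulgA E' -!mulgA; apply/NT; apply/Nv.
  case: e; last by rewrite mulg1; exists 0%R, 0%R, 0%R, true; rewrite /sap_word trans0 !mul1g.
  by rewrite expg1 aa_trans.
have NM g1 h : N g1 -> N h -> N (g1 * h).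
  move=> [x [y [k [e ->]]]] Nh; rewrite /sap_word -!mulgA; apply/NT; apply/Nv.
  by case: e; rewrite ?expg1 ?mul1g //; apply/Na.
have Ng i : N (pgen (sapphire_rels B) i).
  case: i.
  - by rewrite -[pgen _ _]/d -trans_d.
  - by rewrite -[pgen _ _]/b -trans_b.
  - by exists 0%R, 0%R, 1%R, false; rewrite /sap_word trans0 mulg1 mul1g.
  - by exists 0%R, 0%R, 0%R, true; rewrite /sap_word trans0 !mul1g.
apply: (@presented_ind _ _ N) => // h [x [y [k [e ->]]]].
rewrite /sap_word !invgM transV -expgzN; apply: (NM) => //; apply/NM; last first.
  by have := Nv (- k)%R _ N1; rewrite mulg1.
case: e; last by rewrite invg1.
by rewrite aV_trans; apply/NT; rewrite -[a]mulg1; apply/Na.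
Qed.

Lemma height_sap_word x y k e z :
  height (sap_word x y k e) z = (if e then k - z else k + z)%R.
Proof.
rewrite /sap_word !heightM height_trans height_v height_a.
by case: e; rewrite [LHS]/= GRing.addrC.
Qed.

Lemma sap_word_of_height k e g : (forall z, height g z = (if e then k - z else k + z)%R) ->
  exists x y, g = sap_word x y k e.
Proof.
have [x [y [l [c ->]]]] := normal_form g; move=> gE; exists x, y.
have := gE 0%R; have := gE 1%R; rewrite !height_sap_word.
by case: c {gE}; case: e => E1 E0; congr sap_word; lia.
Qed.

(** From here on, computations modulo <d, b> are done in the group of bijections of
the integers. *)
Lemma height_eq1 g : height g = 1 -> exists x y, g = T x y.
Proof.
move=> g1; have [|x [y gE]] := @sap_word_of_height 0%R false g.
  by move=> z; rewrite g1 GRing.add0r.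
by exists x, y; rewrite gE /sap_word !mulg1.
Qed.

Lemma height_eq g h : height g = height h -> exists x y, g = T x y * h.
Proof.
move=> gh; have [|x [y E']] := @height_eq1 (g * h^-1).
  by rewrite heightM (gmorphV heightM) gh mulgV.
by exists x, y; rewrite -E' mulgVK.
Qed.

End SapphireAction.

(** * Inner automorphisms and outer classes *)

Section InnerAutomorphisms.

Variable G : groupType.

Lemma conj_autom_morph (g : G) : {morph (fun x => g * x * g^-1) : x y / x * y}.
Proof. by move=> x y; rewrite !mulgA mulgVK. Qed.

Lemma conj_autom_bij (g : G) : bijective (fun x => g * x * g^-1).
Proof.
exists (fun x => g^-1 * x * g) => x; rewrite !mulgA ?mulVg ?mulgV mul1g.
  by rewrite mulgVK.
by rewrite mulgK.
Qed.

Definition conj_autom (g : G) : autom G :=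
  Autom (conj_autom_morph g) (conj_autom_bij g).

Lemma conj_automE g x : conj_autom g x = g * x * g^-1.
Proof. by []. Qed.

Lemma conj_autom_inner g : inner (conj_autom g).
Proof. by exists g. Qed.

(** Composing with an inner automorphism does not change the outer class. *)
Lemma oclass_conj g (f : autom G) : oclass (conj_autom g * f) = oclass f.
Proof.
apply/oclassP; rewrite invgM -mulgA.
have := innerJ f^-1 (innerV (conj_autom_inner g)).
by rewrite invgK -mulgA.
Qed.

Lemma oclass_inner (f : autom G) : oclass f = 1 <-> inner f.
Proof.
rewrite -[1]/(oclass 1); split=> [/esym/oclassP|fi].
  by rewrite invg1 mul1g.
by apply/esym/oclassP; rewrite invg1 mul1g.
Qed.

Lemma autom_mulE (f g : autom G) x : (f * g) x = f (g x).
Proof. by []. Qed.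

Lemma autom_surj (f : autom G) y : exists x, f x = y.
Proof. by exists (autom_inv f y); apply: autom_Kinv. Qed.

Lemma oclass_morph : {morph (@oclass G) : f g / f * g}.
Proof. exact: oclassM. Qed.

End InnerAutomorphisms.

(** * The subgroup generated by d and b is characteristic *)

Section CharacteristicTranslations.

Variables r s t u : int.
Hypothesis det : (r * u - s * t = 1)%R.
Hypothesis nz : (r * s * t * u <> 0)%R.
Local Notation B := (mx22 r s t u).
Local Notation E := (sapphire B).
Local Notation d := (sap_d B).
Local Notation b := (sap_b B).
Local Notation v := (sap_v B).
Local Notation a := (sap_a B).
Local Notation T := (trans B).
Local Notation m := (r * u + s * t)%R.
Local Notation height := (@height r s t u).

Lemma height1_trans g : height g = 1 <-> exists x y, g = T x y.
Proof.
by split=> [/height_eq1|[x [y ->]]]; [apply | apply: height_trans].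
Qed.

Lemma trans_conj g x y : exists x' y', g * T x y = T x' y' * g.
Proof.
have [|x' [y' gE]] := (height1_trans (g * T x y * g^-1)).1.
  by rewrite !heightM height_trans mulg1 gmorphV ?mulgV //; apply: heightM.
by exists x', y'; rewrite -gE mulgVK.
Qed.

Lemma transC x y x' y' : T x y * T x' y' = T x' y' * T x y.
Proof. by rewrite !transD (GRing.addrC x) (GRing.addrC y). Qed.

(** A condition invariant under automorphisms, which singles out <d, b>. *)
Definition commutes_with_conjugates (g : E) := forall h, commute g (h * g * h^-1).

(** If g acts on Z^2 by L, then g commutes with its conjugate by T p exactly when it
commutes with T (p - L p), that is, when L (p - L p) = p - L p. So commuting with
all conjugates forces (L - 1)^2 = 0. *)
Lemma commutes_with_conjugates_trans g x y x1 y1 x2 y2 :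
  commutes_with_conjugates g ->
  g * T x y = T x1 y1 * g -> g * T x1 y1 = T x2 y2 * g ->
  (2 * x1 = x + x2 /\ 2 * y1 = y + y2)%R.
Proof.
move=> gC g1 g2; have := gC (T x y); rewrite /commute.
have inv1 : g * T (- x)%R (- y)%R = T (- x1)%R (- y1)%R * g.
  by rewrite -!transV; apply: (mulIg (T x y)); rewrite -!mulgA mulVg g1 mulg1 mulKg.
have inv2 : g * T (- x1)%R (- y1)%R = T (- x2)%R (- y2)%R * g.
  by rewrite -!transV; apply: (mulIg (T x1 y1)); rewrite -!mulgA mulVg g2 mulg1 mulKg.
have -> : T x y * g * (T x y)^-1 = T (x - x1)%R (y - y1)%R * g.
  by rewrite transV -mulgA inv1 mulgA transD.
rewrite mulgA.
have -> : g * T (x - x1)%R (y - y1)%R = T (x1 - x2)%R (y1 - y2)%R * g.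
  by rewrite -transD mulgA g1 -mulgA inv2 mulgA transD.
by move=> /mulIg/mulIg/(trans_inj det) [] *; split; lia.
Qed.

(** Equivalently theta is hyperbolic: its half trace m satisfies m^2 = 1 + 4 r s t u.
It holds because r u = 1 + s t, and x (1 + x) > 0 for an integer x other than
0 and -1. *)
Lemma rstu_pos : (0 < r * s * t * u)%R.
Proof.
have rstuE : (r * s * t * u = (s * t) * (1 + s * t))%R by rewrite -det; ring.
by move: nz; rewrite rstuE; nia.
Qed.

Lemma su_neq0 : (s * u <> 0)%R.
Proof.
move=> su; apply: nz; transitivity (r * t * (s * u))%R; first by ring.
by rewrite su GRing.mulr0.
Qed.

Lemma rt_neq0 : r <> 0%R /\ t <> 0%R.
Proof.
by split=> z; apply: nz; rewrite z; ring.
Qed.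

(** The power theta^n equals p + q (theta - m), with p^2 - 4 r s t u q^2 = 1 its
determinant. Multiplication by theta takes (p, q) to (m p + 4 r s t u q, m q + p);
the invariant 0 <= m q p says that the two terms of m q + p do not cancel, which
is why q never returns to 0, whatever the sign of m. *)
Lemma v_pow_trans (n : nat) : exists p q : int,
  [/\ forall x y, v ^+ n * T x y =
        T (p * x - 2 * r * t * q * y)%R (p * y - 2 * s * u * q * x)%R * v ^+ n,
      (p * p = 1 + 4 * (r * s * t * u) * (q * q))%R,
      (0 <= m * (q * p))%R & 0 < n -> q <> 0%R].
Proof.
elim: n => [|n [p [q [pq norm sgn _]]]].
  exists 1%R, 0%R; split=> [x y|||]; last done.
  - by rewrite mul1g mulg1; congr T; ring.
  - by lia.
  by rewrite GRing.mul0r GRing.mulr0.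
have mm := half_trace_sq det; have R0 := rstu_pos.
set R := (r * s * t * u)%R in mm norm R0 *.
have qq : (0 <= q * q)%R by nia.
have Rqq : (0 <= R * (q * q))%R by apply: Num.Theory.mulr_ge0 => //; lia.
exists (m * p + 4 * R * q)%R, (m * q + p)%R; split=> [x y|||_].
- rewrite expgS -mulgA pq mulgA v_trans // -!mulgA.
  by congr (T _ _ * _); rewrite /R; ring.
- set M := m in mm sgn *.
  have -> : ((M * p + 4 * R * q) * (M * p + 4 * R * q) =
      (M * M) * (p * p) + 16 * R * R * (q * q) + 8 * R * (M * (q * p)))%R by ring.
  rewrite norm mm.
  transitivity (1 + 4 * R * ((M * M) * (q * q) + 2 * (M * (q * p)) + p * p))%R.
    by rewrite norm mm; ring.
  by ring.
- set M := m in mm sgn *.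
  have -> : (M * ((M * q + p) * (M * p + 4 * R * q)) =
      (M * M + 4 * R) * (M * (q * p)) + M * M * (p * p + 4 * R * (q * q)))%R by ring.
  rewrite norm mm; apply/Num.Theory.addr_ge0; apply: Num.Theory.mulr_ge0 => //; lia.
set M := m in mm sgn *; move=> q'0.
have : ((M * q + p) * (M * q + p) =
    M * M * (q * q) + 2 * (M * (q * p)) + p * p)%R by ring.
by rewrite q'0 norm mm; lia.
Qed.

(** The upper left entry of (theta^n - 1)^2 is (p - 1)^2 + 4 r s t u q^2, which is
positive. *)
Lemma v_pow_not_commuting x y (n : nat) :
  0 < n -> ~ commutes_with_conjugates (T x y * v ^+ n).
Proof.
move=> n0 gC; have [p [q [pq norm _ q0]]] := v_pow_trans n.
have gT x' y' : T x y * v ^+ n * T x' y' =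
    T (p * x' - 2 * r * t * q * y')%R (p * y' - 2 * s * u * q * x')%R * (T x y * v ^+ n).
  by rewrite -mulgA pq !mulgA transC.
have [+ _] := commutes_with_conjugates_trans gC (gT 1%R 0%R) (gT _ _).
have R0 := rstu_pos; have qq := q0 n0.
have -> : (1 + (p * (p * 1 - 2 * r * t * q * 0) -
      2 * r * t * q * (p * 0 - 2 * s * u * q * 1)) =
    1 + p * p + 4 * (r * s * t * u) * (q * q))%R by ring.
by nia.
Qed.

(** Here the square of g is a translation, so L^2 = 1, and (L - 1)^2 = 0 gives L = 1.
But L is theta^k composed with diag(1, -1); then theta^k would be diag(1, -1),
which does not commute with theta. *)
Lemma reflection_not_commuting g x y k :
  g = sap_word r s t u x y k true -> ~ commutes_with_conjugates g.
Proof.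
move=> gE gC.
have gT x' y' : g * T x' y' = T x' y' * g.
  have [x1 [y1 g1]] := trans_conj g x' y'; have [x2 [y2 g2]] := trans_conj g x1 y1.
  (* A reflection of the line squares to the identity, so g * g is a translation. *)
  have [x3 [y3 gg]] : exists x3 y3, g * g = T x3 y3.
    apply/height1_trans/bijectionP => z; rewrite heightM.
    apply: (@etrans _ _ (height g (height g z))) => //.
    by rewrite gE !height_sap_word; apply: (@etrans _ _ z) => //; lia.
  have [xx yy] : x2 = x' /\ y2 = y'.
    apply: (trans_inj det); apply: (mulIg (g * g)).
    by rewrite [LHS]mulgA -g2 -mulgA -g1 mulgA gg transC.
  have [X Y] := commutes_with_conjugates_trans gC g1 g2.
  by rewrite g1; congr (T _ _ * _); lia.
have vT x' y' : v ^z k * T x' y' = T x' (- y')%R * v ^z k.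
  have := gT x' (- y')%R; rewrite gE /sap_word expg1 -!mulgA a_trans GRing.opprK.
  move=> h; apply: (mulIg a); apply: (mulgI (T x y)).
  by rewrite -!mulgA h [LHS]mulgA [RHS]mulgA transC.
have := congr1 (fun g => v * g) (vT 1%R 0%R).
rewrite (mulgA v (T _ _)) (mulgA v (v ^z k)) v_trans //.
have -> : v * v ^z k = v ^z k * v by rewrite -{1 3}(expgz1 v) expgzC.
rewrite -mulgA v_trans // mulgA vT -!mulgA.
have -> : v * v ^z k = v ^z k * v by rewrite -{1 3}(expgz1 v) expgzC.
by have := su_neq0; move=> + /mulIg/(trans_inj det) [_]; lia.
Qed.

(** This characterizes <d, b> in the language of groups, so every automorphism
preserves it, and therefore acts on the infinite dihedral quotient. *)
Lemma trans_char g :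
  (exists x y, g = T x y) <-> commutes_with_conjugates g.
Proof.
split=> [[x [y gE]] h|gC].
  have [x' [y' hT]] := trans_conj h x y.
  by rewrite gE hT mulgK /commute transC.
have [x [y [k [[] gE]]]] := normal_form det g.
  by case: (reflection_not_commuting gE).
case: k gE => [[|n]|n] gE.
- by exists x, y; rewrite gE /sap_word !mulg1.
- case: (@v_pow_not_commuting x y n.+1 isT).
  by rewrite [T x y * _](_ : _ = g) // gE /sap_word mulg1.
have gC' : commutes_with_conjugates g^-1.
  move=> h; apply/commute_sym; have := commuteV (commute_sym (commuteV (gC h))).
  by rewrite !invgM invgK mulgA.
have [|x' [y' gVE]] := @sap_word_of_height _ _ _ _ det n.+1 false g^-1.
  move=> z; rewrite (gmorphV (@heightM r s t u)).
  have -> : height g = int_shift (Negz n).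
    by apply: bijectionP => z'; rewrite gE height_sap_word GRing.addrC.
  by rewrite GRing.addrC.
case: (@v_pow_not_commuting x' y' n.+1 isT).
by rewrite [T x' y' * _](_ : _ = g^-1) // gVE /sap_word mulg1.
Qed.

End CharacteristicTranslations.

(** * Automorphisms modulo inner ones *)

Lemma mulz1_sign (x y : int) : (x * y = 1)%R -> x = 1%R \/ x = (-1)%R.
Proof.
move=> xy; have : (`|x| * `|y| = 1)%N by rewrite -abszM xy.
by move=> /eqP; rewrite muln_eq1 => /andP[/eqP x1 _]; lia.
Qed.

Lemma int_parity (k : int) : exists (q : int) (c : bool), (2 * q + k = c :> int)%R.
Proof.
elim/int_rect: k => [|k [q [c kE]]|k [q [c kE]]]; first by exists 0%R, false.
  by case: c kE => kE; [exists (q - 1)%R, false | exists q, true]; move: kE => /=; lia.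
by case: c kE => kE; [exists q, false | exists (q + 1)%R, true]; move: kE => /=; lia.
Qed.

Section NormalizedAutomorphisms.

Variables r s t u : int.
Hypothesis det : (r * u - s * t = 1)%R.
Hypothesis nz : (r * s * t * u <> 0)%R.
Local Notation B := (mx22 r s t u).
Local Notation E := (sapphire B).
Local Notation d := (sap_d B).
Local Notation b := (sap_b B).
Local Notation v := (sap_v B).
Local Notation a := (sap_a B).
Local Notation T := (trans B).
Local Notation height := (@height r s t u).
Local Notation hM := (@heightM r s t u).

Lemma heightV g : height g^-1 = (height g)^-1.
Proof. exact: (gmorphV hM). Qed.

Lemma height_of_v : height v = int_shift 1.
Proof. by have [_ _ -> _] := heightE r s t u. Qed.

Lemma height_of_a : height a = int_flip.
Proof. by have [_ _ _ ->] := heightE r s t u. Qed.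

Definition int_dihedral (k : int) (e : bool) : bijection int :=
  int_shift k * (if e then int_flip else 1).

Lemma int_dihedralE k e z : int_dihedral k e z = (if e then k - z else k + z)%R.
Proof. by case: e; rewrite [LHS]/= GRing.addrC. Qed.

Lemma height_dihedral g : exists k e, height g = int_dihedral k e.
Proof.
have [x [y [k [e ->]]]] := normal_form det g; exists k, e.
by apply: bijectionP => z; rewrite height_sap_word int_dihedralE.
Qed.

Lemma autom_trans (f : autom E) x y : exists x' y', f (T x y) = T x' y'.
Proof.
apply/(trans_char det nz) => h; have [h' <-] := autom_surj f h.
have /(_ h') : commutes_with_conjugates (T x y) by apply/trans_char => //; exists x, y.
rewrite /commute -(gmorphV (automM f)) -!automM => ->.
by rewrite !automM.
Qed.

Lemma autom_height1 (f : autom E) g : height (f g) = 1 <-> height g = 1.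
Proof.
rewrite !height1_trans //; split=> -[x [y gE]]; last by rewrite gE; apply: autom_trans.
have [x' [y' E']] := autom_trans (autom_inv f) x y; exists x', y'.
by rewrite -E' -gE autom_invK.
Qed.

Lemma autom_height_eq (f : autom E) g h : height g = height h -> height (f g) = height (f h).
Proof.
move=> gh; apply: divg1_eq; rewrite -heightV -heightM -(gmorphV (automM f)) -automM.
by apply/autom_height1; rewrite heightM heightV gh mulgV.
Qed.

(** Modulo <d, b>, f maps the reflection a to a reflection, since a has order two
there and its image is not trivial; v has infinite order and is mapped to a
translation, by 1 or -1 because f is surjective. *)
Lemma autom_height (f : autom E) : exists j k : int,
  [/\ j = 1%R \/ j = (-1)%R, height (f v) = int_shift j
    & height (f a) = int_dihedral k true].
Proof.
have [j [e fv]] := height_dihedral (f v).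
have [k [e' fa]] := height_dihedral (f a).
have eF : e = false.
  case: e fv => // fv; have : height (f (v * v)) = 1.
    rewrite automM heightM fv; apply: bijectionP => z.
    apply: (@etrans _ _ (j - (j - z))%R); last exact: GRing.subKr.
    by rewrite [LHS](int_dihedralE j true) int_dihedralE.
  move/autom_height1/(congr1 (fun g : bijection int => g 0%R)).
  by rewrite heightM height_of_v.
have e'T : e' = true.
  case: e' fa => // fa; have : height (f (a * a)) = 1.
    by apply/autom_height1; rewrite aa_trans height_trans.
  move=> /(congr1 (fun g : bijection int => g 0%R)); rewrite automM heightM fa.
  rewrite [X in X = _](int_dihedralE k false) int_dihedralE => k0.
  have {}k0 : (k + (k + 0) = 0)%R := k0.
  have {}k0 : k = 0%R by lia.
  have : height (f a) = 1.
    by rewrite fa k0; apply: bijectionP => z; rewrite int_dihedralE GRing.add0r.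
  move/autom_height1; rewrite height_of_a.
  by move/(congr1 (fun g : bijection int => g 1%R)).
rewrite {}eF in fv; rewrite {}e'T in fa; rewrite /int_dihedral mulg1 in fv.
exists j, k; split=> //.
have [g gv] := autom_surj f v; have [i [c gE]] := height_dihedral g.
have gE' : height g = height (v ^z i * a ^+ c).
  by rewrite gE heightM height_v height_a.
have := autom_height_eq f gE'; rewrite gv automM (gmorph_gz (automM f)) height_of_v.
have fvi : height (f v ^z i) = int_shift (j * i)%R.
  by rewrite (gmorph_gz hM) fv int_shiftz -expgzM -int_shiftz.
rewrite heightM fvi.
case: c {gE gE'}; rewrite ?expg1 ?fa ?(gmorph1 (automM f)) ?(gmorph1 hM) ?mulg1 => h.
  have := congr1 (fun g : bijection int => g 0%R) h.
  have := congr1 (fun g : bijection int => g 1%R) h.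
  rewrite /= => *; lia.
have := congr1 (fun g : bijection int => g 0%R) h; rewrite /= !GRing.add0r => ji.
exact: (mulz1_sign (esym ji)).
Qed.

(** Conjugation by a changes the sign of the translation f v, and conjugation by v^i
moves the center of the reflection f a by i, that is, adds 2 i to k. What remains
is the parity c of k, the only invariant of f on the quotient. *)
Lemma autom_normalize (f : autom E) : exists (g : E) (c : bool),
  height ((conj_autom g * f) v) = height v /\
  height ((conj_autom g * f) a) = height (v ^+ c * a).
Proof.
have [j [k [jE fv fa]]] := autom_height f.
pose e := j != 1%R; pose k' := (if e then - k else k)%R.
have [i [c ic]] := int_parity k'; exists (v ^z i * a ^+ e), c.
rewrite !autom_mulE /=.
have hc (x : E) : height (v ^z i * a ^+ e * x * (v ^z i * a ^+ e)^-1) =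
    int_dihedral i e * height x * (int_dihedral i e)^-1.
  by rewrite !heightM heightV heightM height_v height_a.
have hca : height (v ^+ c * a) = int_dihedral c true.
  by rewrite heightM (height_v r s t u c) height_of_a.
rewrite !hc fv fa hca height_of_v.
have moveR (X : Type) (x y z : bijection X) : (forall p, x (y p) = z (x p)) -> x * y * x^-1 = z.
  by move=> xyz; apply: (mulIg x); rewrite mulgVK; apply: bijectionP.
split; apply: moveR => z; rewrite !int_dihedralE.
  by rewrite /e /=; case: jE => -> /=; lia.
by move: ic; rewrite /k'; case: (e) => /=; lia.
Qed.

End NormalizedAutomorphisms.

(** * Automorphisms trivial on the infinite dihedral quotient *)

Section Twists.

Variables r s t u : int.
Hypothesis det : (r * u - s * t = 1)%R.
Local Notation B := (mx22 r s t u).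
Local Notation E := (sapphire B).
Local Notation d := (sap_d B).
Local Notation b := (sap_b B).
Local Notation v := (sap_v B).
Local Notation a := (sap_a B).
Local Notation T := (trans B).
Local Notation m := (r * u + s * t)%R.
Local Notation w1 := (r - r * u - s * t)%R.
Local Notation w2 := (s - 2 * s * u)%R.
Local Notation height := (@height r s t u).
Local Notation hM := (@heightM r s t u).

(** Polynomial identities that hold modulo r u - s t = 1, with an explicit
cofactor. *)
Lemma eq_mod_det (c x y : int) : (x - y = c * (r * u - s * t - 1))%R -> x = y.
Proof. by rewrite det GRing.subrr GRing.mulr0 => /eqP; rewrite GRing.subr_eq0 => /eqP. Qed.

(** An endomorphism that restricts to an automorphism of <d, b> and induces one of the
dihedral quotient is an automorphism. *)
Lemma bijective_of_endo (f : E -> E) (p q p' q' e : int) (c : bool) :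
  {morph f : g h / g * h} -> f d = T p q -> f b = T p' q' ->
  (p * q' - q * p' = e)%R -> (e * e = 1)%R ->
  height (f v) = height v -> height (f a) = height (v ^+ c * a) ->
  bijective f.
Proof.
move=> fM fd fb pqe ee fv fa.
have fT x y := morph_trans_lin x y fM fd fb.
apply: inj_surj_bij.
  apply: (gmorph_inj fM) => g; have [x [y [k [j ->]]]] := normal_form det g.
  rewrite /sap_word !fM fT !(gmorph_gz fM) => f1.
  have hv : height (f v ^z k) = int_shift k.
    by rewrite (gmorph_gz hM) fv height_of_v -int_shiftz.
  have hca : height (v ^+ c * a) = int_dihedral c true.
    by rewrite hM (height_v r s t u c) height_of_a.
  have := congr1 height f1; rewrite !hM height_trans mul1g hv (gmorph1 hM).
  case: j f1 => f1; rewrite ?expg1 ?fa ?hca => h1.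
    have h1z z : (int_dihedral c true z + k = z)%R.
      exact: (congr1 (fun g : bijection int => g z) h1).
    by have := h1z 0%R; have := h1z 1%R; rewrite !int_dihedralE; lia.
  have := congr1 (fun g : bijection int => g 0%R) h1.
  rewrite (gmorph1 fM) (gmorph1 hM) mulg1 => k0.
  have {}k0 : (0 + k = 0)%R := k0.
  have {}k0 : k = 0%R by lia.
  move: f1; rewrite k0 (gmorph1 fM) !mulg1 => /(trans_eq1 det) [e1 e2].
  suff [-> ->] : x = 0%R /\ y = 0%R by apply: trans0.
  have x0 : (e * x = q' * (p * x + p' * y) - p' * (q * x + q' * y))%R by rewrite -pqe; ring.
  have y0 : (e * y = p * (q * x + q' * y) - q * (p * x + p' * y))%R by rewrite -pqe; ring.
  rewrite e1 e2 !GRing.mulr0 GRing.subrr in x0 y0.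
  by split; rewrite -[LHS]GRing.mul1r -ee -GRing.mulrA ?x0 ?y0 GRing.mulr0.
have fST x y : exists g, f g = T x y.
  exists (T (e * (q' * x - p' * y))%R (e * (p * y - q * x))%R); rewrite fT.
  have -> : (p * (e * (q' * x - p' * y)) + p' * (e * (p * y - q * x)) =
      e * (p * q' - q * p') * x)%R by ring.
  have -> : (q * (e * (q' * x - p' * y)) + q' * (e * (p * y - q * x)) =
      e * (p * q' - q * p') * y)%R by ring.
  by rewrite pqe ee !GRing.mul1r.
have fSv : exists g, f g = v.
  have [x [y fvE]] := height_eq det fv; have [g gE] := fST x y.
  by exists (g^-1 * v); rewrite fM (gmorphV fM) gE fvE mulKg.
have fSa : exists g, f g = a.
  have [x [y faE]] := height_eq det fa; have [g gE] := fST x y; have [h hE] := fSv.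
  exists (h ^- c * (g^-1 * a)); rewrite !fM !(gmorphV fM) gE faE mulKg.
  by rewrite (gmorph_gz fM (Posz c)) hE mulKg.
apply: presented_ind => [[]||_ _ [g <-] [h <-]|_ [g <-]].
- by rewrite -[pgen _ _]/d -trans_d; apply: fST.
- by rewrite -[pgen _ _]/b -trans_b; apply: fST.
- exact: fSv.
- exact: fSa.
- by exists 1; apply: gmorph1.
- by exists (g * h); apply: fM.
- by exists g^-1; apply: gmorphV.
Qed.

Lemma v_conj_rel x y p q :
  T x y * v * T p q * (T x y * v)^-1 = T (m * p - 2 * r * t * q)%R (m * q - 2 * s * u * p)%R.
Proof.
apply: (mulIg (T x y * v)); rewrite mulgVK -!mulgA v_trans // !mulgA.
by rewrite transC.
Qed.

Lemma aa_rel x y : T x y * a * (T x y * a) = T (2 * x + 1)%R 0.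
Proof.
rewrite -!mulgA (mulgA a) a_trans -!mulgA aa_trans !transD.
by congr T; ring.
Qed.

Lemma ab_rel x y p q :
  T x y * a * T p q = (T p q)^-1 * (T x y * a) <-> p = 0%R.
Proof.
rewrite -mulgA a_trans transV !mulgA !transD.
split=> [/mulIg/(trans_inj det) [xp _]|->]; first by lia.
by congr (T _ _ * _); ring.
Qed.

(** With v_conj_rel, aa_rel and ab_rel, this turns the defining relations, evaluated
at T x v and T y a, into equations on x and y. It serves both to construct
automorphisms and to classify them. *)
Lemma av_rel x1 x2 y1 y2 z1 z2 :
  T y1 y2 * a * (T x1 x2 * v) * (T y1 y2 * a)^-1 = T z1 z2 * (T x1 x2 * v)^-1 <->
  (y1 + x1 + w1 = z1 + (m * (y1 - x1) + 2 * r * t * (y2 - x2)))%R /\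
  (y2 - x2 + w2 = z2 + (m * (y2 - x2) + 2 * s * u * (y1 - x1)))%R.
Proof.
have -> : T y1 y2 * a * (T x1 x2 * v) =
    T (y1 + x1 + w1)%R (y2 - x2 + w2)%R * (v^-1 * a).
  by rewrite -mulgA (mulgA a) a_trans -mulgA a_v !mulgA !transD.
have VE : T z1 z2 * (T x1 x2 * v)^-1 * (T y1 y2 * a) =
    T (z1 + (m * (y1 - x1) + 2 * r * t * (y2 - x2)))%R
      (z2 + (m * (y2 - x2) + 2 * s * u * (y1 - x1)))%R * (v^-1 * a).
  rewrite invgM transV -!mulgA (mulgA (T _ _) (T _ _)) transD (mulgA v^-1) vV_trans //.
  by rewrite -mulgA [LHS]mulgA transD; congr (T _ _ * _); ring.
split=> [EQ|[-> ->]]; last by rewrite -VE mulgK.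
have : T (y1 + x1 + w1)%R (y2 - x2 + w2)%R * (v^-1 * a) =
    T z1 z2 * (T x1 x2 * v)^-1 * (T y1 y2 * a).
  by rewrite -EQ mulgVK.
by rewrite VE => /mulIg/(trans_inj det).
Qed.

Definition sgn (e : bool) : int := if e then (-1)%R else 1%R.

(** The automorphisms acting trivially on the dihedral quotient. On <d, b> they
commute with theta and with diag(1, -1), hence are 1 or -1 according to e; n and k
then parametrize the solutions of the relations. For e = true the constants
1 - r, s and -1 are a particular solution, and the remaining equation is
u X = t (n - Y), whose solutions are X = t k, Y = n - u k as t and u are coprime. *)
Definition is_twist (e : bool) (n k : int) (f : E -> E) :=
  [/\ f b = T 0 (sgn e),
      f v = T ((if e then 1 - r else 0) + t * k)%R ((if e then s else 0) + n - u * k)%R * v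
    & f a = T (if e then -1 else 0)%R n * a].

Lemma is_twist_d e n k f : {morph f : g h / g * h} -> is_twist e n k f -> f d = T (sgn e) 0.
Proof.
move=> fM [_ _ fa]; have [_ _ _ [<- _ _]] := sap_rels r s t u.
by rewrite fM fa aa_rel; case: e {fa}.
Qed.

Lemma sap_morph_eq (G : groupType) (f g : E -> G) :
  {morph f : x y / x * y} -> {morph g : x y / x * y} ->
  f b = g b -> f v = g v -> f a = g a -> f =1 g.
Proof.
move=> fM gM fb fv fa; apply: presented_morph_eq => // -[] //.
by have [_ _ _ [aa _ _]] := sap_rels r s t u; rewrite -[pgen _ _]/d -aa fM gM fa.
Qed.

Lemma is_twist_inj e n k (f g : autom E) : is_twist e n k f -> is_twist e n k g -> f = g.
Proof.
move=> [fb fv fa] [gb gv ga]; apply/automP/sap_morph_eq; try exact: automM.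
- by rewrite fb.
- by rewrite fv.
- by rewrite fa.
Qed.

Lemma twist_exists e n k : exists f : autom E, is_twist e n k f.
Proof.
set x1 := ((if e then 1 - r else 0) + t * k)%R.
set x2 := ((if e then s else 0) + n - u * k)%R.
pose y1 : int := (if e then -1 else 0)%R.
have [|f [fd fb fv fa]] := @sap_lift r s t u E
  (T (sgn e) 0) (T 0 (sgn e)) (T x1 x2 * v) (T y1 n * a).
  split; rewrite ?transz ?transD ?v_conj_rel.
  - by congr T; ring.
  - by congr T; ring.
  - by congr T; ring.
  split.
  - by rewrite aa_rel /y1; case: (e).
  - exact/ab_rel.
  rewrite ?transz ?transD; apply/av_rel; rewrite /x1 /x2 /y1.
  case: (e) => /=; split.
  - by apply: (@eq_mod_det (- (r + t * k))%R); ring.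
  - by apply: (@eq_mod_det (- (s + u * k))%R); ring.
  - by apply: (@eq_mod_det (- (t * k))%R); ring.
  - by apply: (@eq_mod_det (- (u * k))%R); ring.
have fbij : bijective f.
  apply: (@bijective_of_endo f (sgn e) 0 0 (sgn e) 1 false) => //.
  - exact: gmulfM.
  - by case: (e).
  - by rewrite fv hM height_trans mul1g.
  - by rewrite fa hM height_trans !mul1g.
by exists (Autom (@gmulfM _ _ f) fbij).
Qed.

Definition twist e n k : autom E := projT1 (cid (twist_exists e n k)).

Lemma twistP e n k : is_twist e n k (twist e n k).
Proof. by rewrite /twist; case: cid. Qed.

Lemma twist_trans e n k x y : twist e n k (T x y) = T (sgn e * x)%R (sgn e * y)%R.
Proof.
have tM := automM (twist e n k); have [tb _ _] := twistP e n k.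
have td := is_twist_d tM (twistP e n k).
by rewrite (morph_trans_lin x y tM td tb); congr T; ring.
Qed.

(** So the twists form Z^2 x|_{-1} Z/2. *)
Lemma twistM e n k e' n' k' :
  twist e n k * twist e' n' k' =
  twist (e (+) e') (n + sgn e * n')%R (k + sgn e * k')%R.
Proof.
apply: is_twist_inj (twistP _ _ _).
have [tb tv ta] := twistP e n k; have [tb' tv' ta'] := twistP e' n' k'.
split; rewrite autom_mulE.
- by rewrite tb' twist_trans; congr T; case: (e); case: (e') => /=; ring.
- rewrite tv' automM twist_trans tv mulgA transD.
  by congr (T _ _ * _); case: (e); case: (e') => /=; ring.
rewrite ta' automM twist_trans ta mulgA transD.
by congr (T _ _ * _); case: (e); case: (e') => /=; ring.
Qed.

Lemma twist1 : twist false 0 0 = 1.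
Proof.
apply: is_twist_inj (twistP _ _ _) _; split.
- by rewrite trans_b.
- by rewrite [X in T X _](_ : _ = 0%R) ?[X in T _ X](_ : _ = 0%R) ?trans0 ?mul1g //=; ring.
- by rewrite trans0 mul1g.
Qed.

Lemma twist_z n k (i : int) : twist false n k ^z i = twist false (i * n)%R (i * k)%R.
Proof.
rewrite (@additive_expgz _ (fun i => twist false (i * n)%R (i * k)%R)) ?GRing.mul1r // => x y.
by rewrite twistM /= !GRing.mul1r !GRing.mulrDl.
Qed.

Hypothesis nz : (r * s * t * u <> 0)%R.

(** The relations for a v a^-1 give u X = t (n - Y) for the normalized coordinates
(X, Y) of f v; the Bezout relation r u - s t = 1 produces the parameter k. *)
Lemma twist_complete (f : autom E) :
  height (f v) = height v -> height (f a) = height a ->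
  exists e n k, f = twist e n k.
Proof.
move=> /(height_eq det) [x1 [x2 fv]] /(height_eq det) [y1 [y2 fa]].
have fM := automM f; have [_ vd _ [aa ab av]] := sap_rels r s t u.
have [p [q fb]] := autom_trans det nz f 0 1; rewrite trans_b in fb.
have fd : f d = T (2 * y1 + 1)%R 0 by rewrite -aa fM fa aa_rel.
have p0 : p = 0%R.
  have := congr1 f ab; rewrite !fM (gmorphV fM) fa fb; exact: (ab_rel _ _ _ _).1.
rewrite {}p0 in fb.
have fT x y := morph_trans_lin x y fM fd fb.
have qE : q = (2 * y1 + 1)%R.
  have := congr1 f vd; rewrite !fM (gmorphV fM) fv fd v_conj_rel -fM -transE fT.
  move=> /(trans_inj det) [_ qE].
  have /eqP : (- (2 * s * u) * (q - (2 * y1 + 1)) = 0)%R.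
    by apply/eqP; rewrite -GRing.subr_eq0; apply/eqP; move: qE; lia.
  by have := su_neq0 nz; rewrite GRing.mulf_eq0 => + /orP [/eqP|/eqP]; lia.
(* The scalar q is invertible because b has a preimage, which must be a translation. *)
have [e qe] : exists e, q = sgn e.
  have [g gE] := autom_surj f b.
  have [x [y gT]] : exists x y, g = T x y.
    by apply/(height1_trans det)/(autom_height1 det nz f); rewrite gE -trans_b height_trans.
  move: gE; rewrite gT fT -trans_b => /(trans_inj det) [_ qy].
  have [|->|->] := @mulz1_sign q y; first by lia.
    by exists false.
  by exists true.
have y1E : y1 = (if e then -1 else 0)%R by move: qE; rewrite qe; case: (e) => /=; lia.
have := congr1 f av; rewrite !fM !(gmorphV fM) fv fa -fM -transE fT => /av_rel [eq1 eq2].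
pose X1 : int := (x1 - (if e then 1 - r else 0))%R.
pose X2 : int := (x2 - (if e then s else 0))%R.
have key : (u * X1 = t * (y2 - X2))%R.
  have : (2 * r * (u * X1 - t * (y2 - X2)) = 0)%R.
    move: eq1 => /eqP; rewrite -GRing.subr_eq0 => /eqP eq1.
    rewrite -[RHS]eq1 y1E /X1 /X2; case: (e).
      by apply: (@eq_mod_det (x1 + 2 * r - 1)%R); ring.
    by apply: (@eq_mod_det x1); ring.
  have [r0 _] := rt_neq0 nz.
  by move/eqP; rewrite GRing.mulf_eq0 => /orP [/eqP|/eqP]; lia.
pose k := (r * (y2 - X2) - s * X1)%R.
have tk : (t * k = X1)%R.
  transitivity (r * (t * (y2 - X2)) - s * t * X1)%R; first by rewrite /k; ring.
  by rewrite -key; apply: (@eq_mod_det X1); ring.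
have uk : (u * k = y2 - X2)%R.
  transitivity (r * u * (y2 - X2) - s * (u * X1))%R; first by rewrite /k; ring.
  by rewrite key; apply: (@eq_mod_det (y2 - X2)%R); ring.
exists e, y2, k; apply: is_twist_inj (twistP _ _ _); split.
- by rewrite fb qe.
- by rewrite fv tk uk /X1 /X2; congr (T _ _ * _); ring.
by rewrite fa y1E.
Qed.

(** An inner automorphism that is trivial on the dihedral quotient is conjugation by
T z, because that quotient has trivial center; it multiplies v by (1 - theta) z and
a by 2 z2. *)
Lemma inner_twist e n k : inner (twist e n k) <->
  e = false /\ exists z1 z2 : int, n = (2 * z2)%R /\ k = (2 * (r * z2 - s * z1))%R.
Proof.
have [tb tv ta] := twistP e n k.
split=> [[g gE]|[e0 [z1 [z2 [nE kE]]]]]; last first.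
  exists (T z1 z2) => x.
  suff -> : twist e n k = conj_autom (T z1 z2) by [].
  rewrite e0 in tb tv ta *.
  apply: is_twist_inj (twistP _ _ _) _; split => /=.
  - by rewrite -trans_b transC mulgK.
  - rewrite transV -mulgA v_trans // mulgA transD nE kE.
    congr (T _ _ * _).
      by apply: (@eq_mod_det (- z1)%R); ring.
    by apply: (@eq_mod_det z2); ring.
  by rewrite transV -mulgA a_trans // mulgA transD nE; congr (T _ _ * _); ring.
have [j [c hg]] := height_dihedral det g.
have hv : height g * height v = height v * height g.
  have := congr1 height (gE v); rewrite tv !hM (gmorphV hM) height_trans mul1g.
  by move=> hv; rewrite [in RHS]hv mulgVK.
have ha : height g * height a = height a * height g.
  have := congr1 height (gE a); rewrite ta !hM (gmorphV hM) height_trans mul1g.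
  by move=> ha; rewrite [in RHS]ha mulgVK.
rewrite hg height_of_v in hv; rewrite hg height_of_a in ha.
have hvz z : int_dihedral j c (z + 1)%R = (int_dihedral j c z + 1)%R.
  exact: (congr1 (fun g : bijection int => g z) hv).
have haz z : int_dihedral j c (- z)%R = (- int_dihedral j c z)%R.
  exact: (congr1 (fun g : bijection int => g z) ha).
have [c0 j0] : c = false /\ j = 0%R.
  have := hvz 0%R; have := haz 0%R; rewrite !int_dihedralE.
  by case: (c); split; lia.
have [z1 [z2 gT]] : exists z1 z2, g = T z1 z2.
  apply/(height1_trans det); rewrite hg c0 j0; apply: bijectionP => z.
  by rewrite int_dihedralE GRing.add0r.
have /(trans_inj det) [_ eb] : T 0 1 = T 0 (sgn e).
  by rewrite -tb gE gT -[in RHS]trans_b transC mulgK trans_b.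
have eF : e = false by case: (e) eb.
rewrite {}eF /= in gE ta tv *; split=> //; exists z1, z2.
have /(trans_inj det) [_ en] : T 0 n = T 0 (2 * z2)%R.
  apply: (mulIg a); rewrite -ta.
  by rewrite gE gT transV -mulgA a_trans // mulgA transD; congr (T _ _ * _); ring.
have : T (t * k)%R (n - u * k)%R =
    T (z1 - m * z1 + 2 * r * t * z2)%R (z2 - m * z2 + 2 * s * u * z1)%R.
  apply: (mulIg v); move: tv; rewrite !GRing.add0r => <-.
  by rewrite gE gT transV -mulgA v_trans // mulgA transD; congr (T _ _ * _); ring.
move=> /(trans_inj det) [tk _]; split=> //.
have /eqP : (t * (k - 2 * (r * z2 - s * z1)) = 0)%R.
  rewrite GRing.mulrBr tk; apply: (@eq_mod_det (- z1)%R); ring.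
have [_ t0] := rt_neq0 nz.
by rewrite GRing.mulf_eq0 => /orP [/eqP|/eqP]; lia.
Qed.

End Twists.

(** * The classes of twists in Out(E) *)

Section OuterTwists.

Variables r s t u : int.
Hypothesis det : (r * u - s * t = 1)%R.
Hypothesis nz : (r * s * t * u <> 0)%R.
Local Notation B := (mx22 r s t u).
Local Notation E := (sapphire B).
Local Notation d := (sap_d B).
Local Notation b := (sap_b B).
Local Notation v := (sap_v B).
Local Notation a := (sap_a B).
Local Notation T := (trans B).
Local Notation height := (@height r s t u).
Local Notation hM := (@heightM r s t u).
Local Notation twist := (twist det).

Definition otwist e n k : outer E := oclass (twist e n k).

Lemma otwistM e n k e' n' k' :
  otwist e n k * otwist e' n' k' = otwist (e (+) e') (n + sgn e * n')%R (k + sgn e * k')%R.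
Proof. by rewrite /otwist -twistM oclass_morph. Qed.

Lemma otwist1 : otwist false 0 0 = 1.
Proof. by rewrite /otwist twist1. Qed.

Lemma otwist_z n k (i : int) : otwist false n k ^z i = otwist false (i * n)%R (i * k)%R.
Proof. by rewrite /otwist -twist_z (gmorph_gz (@oclass_morph E)). Qed.

Lemma otwist_eq1 e n k : otwist e n k = 1 <->
  e = false /\ exists z1 z2 : int, n = (2 * z2)%R /\ k = (2 * (r * z2 - s * z1))%R.
Proof. by rewrite oclass_inner inner_twist. Qed.

(** The lattice of inner twists is spanned by (0, 2 s) and (2, 2 r) in the coordinates
(n, k). *)
Lemma otwist_eq e n k n' k' (z1 z2 : int) :
  (n = n' + 2 * z2)%R -> (k = k' + 2 * (r * z2 - s * z1))%R ->
  otwist e n k = otwist e n' k'.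
Proof.
move=> -> ->; have tz : otwist false (2 * z2)%R (2 * (r * z2 - s * z1))%R = 1.
  by apply/otwist_eq1; split=> //; exists z1, z2.
rewrite -[RHS]mul1g -tz otwistM /=.
by congr otwist; ring.
Qed.

Variable c : int.
Local Notation alpha := (otwist false 1 r).
Local Notation beta := (otwist false 0 1).
Local Notation rho := (otwist true 0 c).

(** The quotient of Z^2 by the lattice spanned by (0, 2 s) and (2, 2 r) is the sum of
Z/2, generated by alpha = (1, r), and of Z/2s, generated by beta = (0, 1). The
reflection rho may be any twist with e = true; c is 0 in the first case of the
theorem and t in the two others. *)
Lemma otwist_word i j (e : bool) :
  alpha ^z i * beta ^z j * rho ^+ e = otwist e i (r * i + j + (if e then c else 0))%R.
Proof.
rewrite !otwist_z otwistM; case: e; rewrite ?expg1 ?mulg1 ?otwistM /=.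
  by congr otwist; ring.
by congr otwist; ring.
Qed.

Lemma otwist_gen e n k : exists i j, otwist e n k = alpha ^z i * beta ^z j * rho ^+ e.
Proof.
exists n, (k - r * n - (if e then c else 0))%R; rewrite otwist_word.
by congr otwist; ring.
Qed.

(** Both signs of k occur: the upper right entry of the matrix is s in the first case
of the theorem and - t in the two others. *)
Lemma otwist_dih_relations k : k = (2 * s)%R \/ k = (- (2 * s))%R ->
  dih_relations k alpha beta rho.
Proof.
move=> kE; split.
- by rewrite otwistM -otwist1; apply: (@otwist_eq _ _ _ _ _ 0 1) => /=; ring.
- rewrite otwist_z -otwist1; case: kE => ->.
    by apply: (@otwist_eq _ _ _ _ _ (-1)%R 0) => /=; ring.
  by apply: (@otwist_eq _ _ _ _ _ 1 0) => /=; ring.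
- by rewrite otwistM -otwist1; congr otwist => /=; ring.
split.
- by rewrite !otwistM; congr otwist => /=; ring.
- by rewrite !otwistM; apply: (@otwist_eq _ _ _ _ _ 0 (-1)%R) => /=; ring.
apply/esym/mulg1_eq; rewrite !otwistM -otwist1; congr otwist => /=; ring.
Qed.

Lemma otwist_dih_free k : k = (2 * s)%R \/ k = (- (2 * s))%R ->
  dih_free k alpha beta rho.
Proof.
move=> kE i j e; rewrite otwist_word => /otwist_eq1 [-> [z1 [z2 [iE jE]]]].
have {}jE : j = (z1 * - (2 * s))%R by move: jE; rewrite iE; lia.
split=> //; first by apply/dvdzP; exists z2; lia.
by apply/dvdzP; case: kE => ->; [exists (- z1)%R | exists z1]; rewrite jE; ring.
Qed.

Lemma twist_height e n k x : height (twist e n k x) = height x.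
Proof.
have [tb tv ta] := twistP det e n k.
apply: (@sap_morph_eq _ _ _ _ _ (height \o twist e n k)) => [g h||||] /=.
- by rewrite automM hM.
- exact: hM.
- by rewrite tb -trans_b !height_trans.
- by rewrite tv hM height_trans mul1g.
- by rewrite ta hM height_trans mul1g.
Qed.

(** The two cases are the two values of the parity in autom_normalize. *)
Lemma outer_cases x : (exists e n k, x = otwist e n k) \/
  exists f : autom E, [/\ x = oclass f, height (f v) = height v
    & height (f a) = height (v * a)].
Proof.
rewrite -(oclass_repr x); set f := repr x.
have [g [[] [hv ha]]] := autom_normalize det nz f.
  by right; exists (conj_autom g * f); rewrite oclass_conj.
rewrite mul1g in ha; have [e [n [k fE]]] := twist_complete det nz hv ha.
by left; exists e, n, k; rewrite /otwist -fE oclass_conj.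
Qed.

Lemma subgroup_gen_trans x y : subgroup_gen [set d; b]%classic (T x y).
Proof.
have gz g n : subgroup_gen [set d; b]%classic g -> subgroup_gen [set d; b]%classic (g ^z n).
  move=> Sg; elim/int_rect: n => [|n IH|n IH]; first exact: subgroup_gen_1.
    have -> : (n.+1%:Z = n%:Z + 1)%R by lia.
    by rewrite expgzSr; apply: subgroup_gen_M.
  have -> : (- n.+1%:Z = - n%:Z - 1)%R by lia.
  by rewrite expgzBr; apply: subgroup_gen_M => //; apply: subgroup_gen_V.
by rewrite transE; apply: subgroup_gen_M; apply: gz; apply: subgroup_gen_in; [left | right].
Qed.

(** Modulo <d, b>, membership in Aut_0^1 says that f fixes v and maps a to v a. *)
Lemma aut01_of_height (f : autom E) :
  height (f v) = height v -> height (f a) = height (v * a) -> aut01 B f.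
Proof.
move=> hv ha; split=> [x Sx|]; last first.
  have [x [y fa]] := height_eq det ha; exists x, y.
  by rewrite fa transE !mulgA.
suff [y [z ->]] : exists y z, f x * x^-1 = T y z by apply: subgroup_gen_trans.
apply/(height1_trans det); rewrite hM (gmorphV hM).
suff -> : height (f x) = height x by rewrite mulgV.
have fT p q : height (f (T p q)) = height (T p q).
  rewrite height_trans; apply/(autom_height1 det nz); exact: height_trans.
elim: Sx => {x} [x [[->|->]|->]||x y _ fx _ fy|x _ fx] //.
- by rewrite -trans_d.
- by rewrite -trans_b.
- by rewrite (gmorph1 (automM f)).
- by rewrite automM !hM fx fy.
by rewrite (gmorphV (automM f)) !(gmorphV hM) fx.
Qed.

Lemma outer_all_twists : aut01 B = set0 -> forall x, exists e n k, x = otwist e n k.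
Proof.
move=> no1 x; case: (outer_cases x) => // -[f [_ hv ha]].
by have := aut01_of_height hv ha; rewrite no1.
Qed.

(* One automorphism of odd parity generates Out(E) over the twists. *)
Variable om : autom E.
Hypotheses (om_v : height (om v) = height v) (om_a : height (om a) = height (v * a)).

Lemma outer_cover x : exists e n k,
  x = otwist e n k \/ x = otwist e n k * oclass om.
Proof.
case: (outer_cases x) => [[e [n [k ->]]]|[f [-> fv fa]]].
  by exists e, n, k; left.
pose h := f * om^-1; have hom y : h (om y) = f y.
  by rewrite /h autom_mulE [om^-1 _](autom_invK om).
have heq := @autom_height_eq r s t u det nz h.
have hv : height (h v) = height v by rewrite (heq v (om v)) // hom.
have ha : height (h a) = height a.
  apply: (mulgI (height v)); rewrite -{1}hv -!hM -automM.
  by rewrite (heq _ (om a)) // hom fa hM.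
have [e [n [k hE]]] := twist_complete det nz hv ha.
by exists e, n, k; right; rewrite /otwist -hE -oclass_morph mulgVK.
Qed.

(** Parity is an invariant of the outer class: conjugating the reflection a moves its
center by an integer, whereas v a is the reflection at 1/2. *)
Lemma om_not_twist e n k : otwist e n k <> oclass om.
Proof.
move=> /oclassP [g gE]; have [j [cc hg]] := height_dihedral det g.
have : height (om a) = height (g * a * g^-1).
  rewrite -gE autom_mulE -[RHS](twist_height e n k).
  by congr (height _); apply/esym; apply: (autom_Kinv (twist e n k)).
rewrite om_a !hM (gmorphV hM) => h1.
have {}h1 : height v * height a * height g = height g * height a by rewrite h1 mulgVK.
rewrite hg height_of_v height_of_a in h1.
have h1z z : (- (int_dihedral j cc z) + 1 = int_dihedral j cc (- z))%R.
  exact: (congr1 (fun g : bijection int => g z) h1).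
by have := h1z 0%R; rewrite !int_dihedralE; case: (cc); lia.
Qed.

End OuterTwists.

(** * An automorphism of odd parity *)

Section SecondInvolution.

Variables r s t u : int.
Hypothesis det : (r * u - s * t = 1)%R.
Local Notation B := (mx22 r s t u).
Local Notation v := (sap_v B).
Local Notation a := (sap_a B).
Local Notation T := (trans B).
Local Notation m := (r * u + s * t)%R.

Lemma va_trans x y :
  v * a * T x y = T (m * x + 2 * r * t * y)%R (- (m * y) - 2 * s * u * x)%R * (v * a).
Proof.
rewrite -mulgA a_trans // mulgA v_trans // -mulgA.
by congr (T _ _ * _); ring.
Qed.

Lemma va_v : v * a * v = T (r - 1)%R (- s)%R * a.
Proof.
rewrite -mulgA a_v mulgA v_trans // -!mulgA mulKVg; congr (T _ _ * _).
  by apply: (@eq_mod_det _ _ _ _ det (r - (r * u - s * t) - 1)%R); ring.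
by apply: (@eq_mod_det _ _ _ _ det (- s)%R); ring.
Qed.

(** The second reflection v a is, like a, a generator of one of the two Klein bottle
groups glued in the sapphire: its square is the translation (r, - s), which it
fixes. *)
Lemma va_sq : v * a * (v * a) = T r (- s)%R.
Proof.
rewrite mulgA va_v -mulgA aa_trans transD.
by congr T; ring.
Qed.

Lemma va_v_rel x1 x2 q1 q2 :
  (q1 = 2 * (m * x1 + 2 * r * t * x2) + r - 1)%R -> (q2 = - s)%R ->
  v * a * (T x1 x2 * v) * (v * a)^-1 = T q1 q2 * (T x1 x2 * v)^-1.
Proof.
move=> -> ->; apply: (mulIg (v * a)); rewrite mulgVK.
rewrite mulgA va_trans // -mulgA va_v mulgA transD.
rewrite [in RHS]invgM transV -!mulgA (mulgA v^-1) vV_trans // -!mulgA mulKg [in RHS]mulgA transD.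
by congr (T _ _ * _); ring.
Qed.

End SecondInvolution.

(* Let M be the matrix with rows (r, s) and (t, r), of determinant eps = 1 (for c = 1)
   or -1 (for c = 0). The matrix of the sapphire is (r, - t; - eps s, eps r), for which
   theta = eps M^2, and J = diag(1, -1) satisfies theta J = M J M^-1: so M carries the
   action of a on Z^2 to that of v a. *)
Section Omega.

Variables r s t c : int.
Local Notation eps := (2 * c - 1)%R.
Hypotheses (cc : c = 0%R \/ c = 1%R) (detM : (r * r - s * t = eps)%R).
Local Notation B := (mx22 r (- t)%R (- (eps * s))%R (eps * r)%R).
Local Notation E := (sapphire B).
Local Notation d := (sap_d B).
Local Notation b := (sap_b B).
Local Notation v := (sap_v B).
Local Notation a := (sap_a B).
Local Notation T := (trans B).
Local Notation height := (@height r (- t)%R (- (eps * s))%R (eps * r)%R).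
Local Notation hM := (@heightM r (- t)%R (- (eps * s))%R (eps * r)%R).

Lemma omega_det : (r * (eps * r) - (- t) * (- (eps * s)) = 1)%R.
Proof.
transitivity (eps * (r * r - s * t))%R; first by ring.
by rewrite detM; case: cc => ->.
Qed.
Local Notation det := omega_det.

Local Notation x1 := (c * (2 * r * r - 1) - r)%R.
Local Notation x2 := (2 * c * r * t - t)%R.

(** Proves a polynomial identity modulo r^2 - s t = 2 c - 1, for c = 0 and c = 1, as a
linear consequence of multiples of this relation by monomials in r, t and k. *)
Ltac mod_detM k :=
  have /= := congr1 (fun z : int => (z * k)%R) detM;
  have /= := congr1 (fun z : int => (z * r)%R) detM;
  have /= := congr1 (fun z : int => (z * t)%R) detM;
  have /= := congr1 (fun z : int => (z * (r * r))%R) detM;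
  have /= := congr1 (fun z : int => (z * (r * t))%R) detM;
  have /= := congr1 (fun z : int => (z * (r * r * r))%R) detM;
  move: detM; case: cc => -> /=; lia.

(** The automorphism that acts by M on <d, b> and carries the reflection a to v a. The
vector (x1, x2) solves the equation coming from a v a^-1. It is
M (r - 1, t) for c = 1 and M (-1, 0) for c = 0, which the formulas for x1 and x2
combine. *)
Definition is_omega (f : E -> E) :=
  [/\ f d = T r t, f b = T s r, f v = T x1 x2 * v & f a = v * a].

Lemma omega_exists : exists f : autom E, is_omega f.
Proof.
have st : (s * t = r * r - eps)%R by rewrite -detM; ring.
have [|f [fd fb fv fa]] := @sap_lift r (- t)%R (- (eps * s))%R (eps * r)%R E
  (T r t) (T s r) (T x1 x2 * v) (v * a).
  split; rewrite ?transz ?transD ?v_conj_rel ?det //.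
  - by congr T; ring.
  - by congr T; ring.
  - by congr T; ring.
  split; first by rewrite va_sq ?det //; congr T; ring.
    rewrite va_trans ?det // transV; congr (T _ _ * _).
      transitivity (- (eps * (r * r - s * t)) * s)%R; first by ring.
      by rewrite detM; case: cc => ->; ring.
    transitivity (- (eps * (r * r - s * t)) * r)%R; first by ring.
    by rewrite detM; case: cc => ->; ring.
  rewrite ?transz ?transD; apply: va_v_rel; rewrite ?det //.
    have e1 := congr1 (fun z => z * r)%R detM; have e2 := congr1 (fun z => z * (r * r))%R detM.
    have e3 := congr1 (fun z => z * (r * r * r))%R detM; rewrite /= in e1 e2 e3.
    by case: cc e1 e2 e3 detM => ->; lia.
  transitivity (t * (eps * (r * r - s * t)))%R; first by ring.
  by rewrite detM; case: cc => ->; ring.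
have fbij : bijective f.
  apply: (@bijective_of_endo _ _ _ _ det f r t s r eps true (@gmulfM _ _ f) fd fb) => //.
  - by rewrite -detM; ring.
  - by case: cc => ->.
  - by rewrite fv hM height_trans mul1g.
  - by rewrite fa expg1.
by exists (Autom (@gmulfM _ _ f) fbij).
Qed.

Definition omega : autom E := projT1 (cid omega_exists).

Lemma omegaP : is_omega omega.
Proof. by rewrite /omega; case: cid. Qed.

Lemma omega_trans x y : omega (T x y) = T (r * x + s * y)%R (t * x + r * y)%R.
Proof. by have [od ob _ _] := omegaP; apply: morph_trans_lin => //; apply: automM. Qed.

Lemma omega_v : height (omega v) = height v.
Proof. by have [_ _ -> _] := omegaP; rewrite hM height_trans mul1g. Qed.

Lemma omega_a : height (omega a) = height (v * a).
Proof. by have [_ _ _ ->] := omegaP. Qed.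

(** On pairs (n, k), the linear part of conjugation by omega is the matrix with rows
(0, 1) and (- eps, 2 r), the companion matrix of M. *)
Lemma omega_twist (e : bool) n k :
  omega * twist det e n k =
  twist det e k (2 * r * k - eps * n - (if e then 2 * t else 0))%R * omega.
Proof.
have [od ob ov oa] := omegaP; have [tb tv ta] := twistP det e n k.
set k' := (2 * r * k - _ - _)%R; have [tb' tv' ta'] := twistP det e k k'.
apply/automP/sap_morph_eq; try exact: automM; rewrite !autom_mulE.
- by rewrite tb ob omega_trans twist_trans; congr T; ring.
- rewrite tv ov !automM omega_trans twist_trans ov tv' !mulgA !transD.
  by congr (T _ _ * _); rewrite /k'; case: (e) => /=; mod_detM k.
rewrite ta oa !automM omega_trans tv' ta' oa.
rewrite -(mulgA _ v) (mulgA v) v_trans ?det // !mulgA !transD.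
by congr (T _ _ * _ * _); rewrite /k'; case: (e) => /=; mod_detM k.
Qed.

(** The square acts by M^2 = eps theta on <d, b> and by conjugation by v on the
dihedral quotient, so only a twist of sign eps remains. *)
Lemma omega_sq : omega * omega = conj_autom v * twist det (c == 0%R) (2 * t)%R 0.
Proof.
have [od ob ov oa] := omegaP; have [tb tv ta] := twistP det (c == 0%R) (2 * t)%R 0.
apply/automP/sap_morph_eq; try exact: automM; rewrite !autom_mulE.
- rewrite conj_automE ob omega_trans tb v_trans ?det // mulgK.
  by congr T; rewrite /sgn; mod_detM r.
- rewrite conj_automE ov automM omega_trans ov tv !mulgA v_trans ?det // mulgK transD.
  by congr (T _ _ * _); mod_detM r.
rewrite conj_automE oa automM ov oa ta !mulgA v_trans ?det //.
rewrite -!mulgA a_vV ?det // (mulgA v (T _ _)) v_trans ?det // !mulgA transD.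
by congr (T _ _ * _ * _ * _); mod_detM r.
Qed.

Hypothesis nz : (r * - t * - (eps * s) * (eps * r) <> 0)%R.

Local Notation ow := (oclass omega).
Local Notation otw := (otwist det).
Local Notation al := (otw false 1 r).
Local Notation be := (otw false 0 1).
(* Conjugation by omega fixes the class of the twist (true, 0, 0). Taking rho = beta^t
   times this class produces the factor alpha^t beta^(t (r + 1)) in ow_rho and
   omega^2 = beta^t rho when c = 0. *)
Local Notation rh := (otw true 0 t).

Lemma ow_twist e n k :
  ow * otw e n k * ow^-1 = otw e k (2 * r * k - eps * n - (if e then 2 * t else 0))%R.
Proof.
by apply: (mulIg ow); rewrite mulgVK -!oclass_morph omega_twist.
Qed.

Lemma ow_alpha : ow * al * ow^-1 = al ^z r * be ^z (s * t)%R.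
Proof.
rewrite ow_twist !otwist_z otwistM; congr otwist => /=; first by ring.
by move: detM; lia.
Qed.

Lemma ow_beta : ow * be * ow^-1 = al * be ^z r.
Proof. by rewrite ow_twist !otwist_z otwistM; congr otwist => /=; ring. Qed.

(** The two sides differ by beta^(4 t) = 1. *)
Lemma ow_rho : ow * rh * ow^-1 = al ^z t * be ^z (t * (r + 1))%R * rh.
Proof.
rewrite ow_twist !otwist_z !otwistM.
by apply: (@otwist_eq _ _ _ _ _ nz _ _ _ _ _ (-2)%R 0) => /=; ring.
Qed.

Lemma ow_sq : ow * ow = if c == 0%R then be ^z t * rh else 1.
Proof.
rewrite -oclass_morph omega_sq oclass_conj -[LHS]/(otw _ _ _).
case: (c == 0%R); last first.
  by rewrite -(otwist1 det); apply: (@otwist_eq _ _ _ _ _ nz _ _ _ _ _ (- r)%R t) => /=; ring.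
rewrite !otwist_z !otwistM.
by apply: (@otwist_eq _ _ _ _ _ nz _ _ _ _ _ (- r - 1)%R t) => /=; ring.
Qed.

End Omega.

(** * The structure of Out(E) *)

(** When no automorphism has odd parity, the twists exhaust Out(E). *)
Lemma out_sapphire_dihedral (r s t u : int) :
  (r * u - s * t = 1)%R -> (r * s * t * u <> 0)%R -> aut01 (mx22 r s t u) = set0 ->
  isomorphic (outer (sapphire (mx22 r s t u))) (presented (out_rels (2 * s)%R)) /\
  isomorphic (outer (sapphire (mx22 r s t u))) (dih `|(2 * s)%R|%N).
Proof.
move=> det nz no1.
apply: (@dihedral_presentation _ _
  (otwist det false 1 r) (otwist det false 0 1) (otwist det true 0 0)).
- by have : s <> 0%R; [move=> s0; apply: nz; rewrite s0; ring | lia].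
- by apply: otwist_dih_relations => //; left.
- by apply: otwist_dih_free => //; left.
move=> g; have [e [n [k ->]]] := outer_all_twists det nz no1 g.
by have [i [j E]] := otwist_gen det 0 e n k; exists i, j, e.
Qed.

Section OmegaExtension.

Variables r s t c : int.
Local Notation eps := (2 * c - 1)%R.
Hypotheses (cc : c = 0%R \/ c = 1%R) (detM : (r * r - s * t = eps)%R).
Hypothesis nz : (r * - t * - (eps * s) * (eps * r) <> 0)%R.
Local Notation B := (mx22 r (- t)%R (- (eps * s))%R (eps * r)%R).
Local Notation det := (omega_det cc detM).
Local Notation ow := (oclass (omega cc detM)).
Local Notation al := (otwist det false 1 r).
Local Notation be := (otwist det false 0 1).
Local Notation rh := (otwist det true 0 t).
Local Notation N := (dih `|(2 * t)%R|%N).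

Let f : N -> outer (sapphire B) := dih_map al be rh.

Lemma omega_order : 1 < `|(2 * t)%R|%N.
Proof.
have : t <> 0%R by move=> t0; apply: nz; rewrite t0; ring.
by lia.
Qed.

Lemma omega_dih_relations : dih_relations (2 * t)%R al be rh.
Proof. by apply: otwist_dih_relations => //; right; ring. Qed.

Lemma omega_dih_inj : injective f.
Proof.
apply: dih_map_inj omega_order omega_dih_relations _.
by apply: otwist_dih_free => //; right; ring.
Qed.

Lemma omega_dih_morph : {morph f : x y / x * y}.
Proof. exact: dih_mapM omega_order omega_dih_relations. Qed.

Lemma omega_dih_word i j (e : bool) : exists x, al ^z i * be ^z j * rh ^+ e = f x.
Proof. by have [x <-] := word_dih_map omega_order omega_dih_relations i j e; exists x. Qed.

Lemma omega_dih_normal x : exists y, ow * f x * ow^-1 = f y.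
Proof.
apply: dih_map_normalized x; rewrite ?ow_alpha ?ow_beta ?ow_rho //.
- exact: omega_order.
- exact: omega_dih_relations.
- by have [x xE] := omega_dih_word r (s * t)%R false; exists x; rewrite -[RHS]/(f x) -xE mulg1.
- by have [x xE] := omega_dih_word 1 r false; exists x; rewrite -[RHS]/(f x) -xE mulg1.
by have [x xE] := omega_dih_word t (t * (r + 1))%R true; exists x; rewrite -[RHS]/(f x) -xE expg1.
Qed.

Lemma omega_not_dih x : f x <> ow.
Proof.
have [i [j [e xE]]] := dih_map_word al be rh x.
rewrite /f xE otwist_word; exact: (om_not_twist nz (omega_a cc detM)).
Qed.

Lemma omega_dih_cover g : exists x, g = f x \/ g = f x * ow.
Proof.
have [e [n [k gE]]] := outer_cover det nz (omega_v cc detM) (omega_a cc detM) g.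
have [i [j E]] := otwist_gen det t e n k; have [x xE] := omega_dih_word i j e.
by exists x; rewrite -xE -E.
Qed.

End OmegaExtension.

Lemma mx22_neq0 (r s t u : int) : (forall i j, mx22 r s t u i j != 0)%R -> (r * s * t * u <> 0)%R.
Proof.
have [B11 B12 B21 B22] := mx22E r s t u; move=> nz; apply/eqP.
have := nz 0%R 0%R; have := nz 0%R 1%R; have := nz 1%R 0%R; have := nz 1%R 1%R.
by rewrite B11 B12 B21 B22 => *; rewrite !GRing.mulf_neq0.
Qed.

Lemma det_mx22 (r s t u : int) : (\det (mx22 r s t u) = r * u - s * t)%R.
Proof.
rewrite (expand_det_row _ 0%R) !big_ord_recl big_ord0 /cofactor !det_mx11 !mxE /=.
by rewrite [(_ ^+ (0 + 0))%R](_ : _ = 1%R) // [(_ ^+ _)%R](_ : _ = (-1)%R) //; ring.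
Qed.

Lemma omega_matrix_det1 (r s t : int) :
  mx22 r (- t)%R (- s)%R r = mx22 r (- t)%R (- ((2 * 1 - 1) * s))%R ((2 * 1 - 1) * r)%R.
Proof. by congr mx22; ring. Qed.

Lemma omega_matrix_detN1 (r s t : int) :
  mx22 r (- t)%R s (- r)%R = mx22 r (- t)%R (- ((2 * 0 - 1) * s))%R ((2 * 0 - 1) * r)%R.
Proof. by congr mx22; ring. Qed.

Theorem theorem4p11 (B : 'M[int]_2) (detB : (\det B = 1)%R)
    (B_neq0 : forall i j, (B i j != 0)%R) :
  [/\ (* I *)
      forall r s t u : int,
        aut01 B = set0 -> B = mx22 r s t u ->
        isomorphic (outer (sapphire B)) (presented (out_rels (2 * s)%R)) /\
        isomorphic (outer (sapphire B)) (dih `|(2 * s)%R|%N),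
      (* II *)
      forall (M0 : 'M[int]_2) (l0 l r s t : int),
        centralizer_root (theta B) M0 ->
        aut01 B !=set0 ->
        l0 = (2 * l)%R -> theta B = (M0 ^ l0)%R ->
        (\det (M0 ^ l) = 1)%R -> (M0 ^ l)%R = mx22 r s t r ->
        B = mx22 r (- t)%R (- s)%R r ->
        let N := dih `|(2 * t)%R|%N in
        let al : N := dih_alpha _ in
        let be : N := dih_beta _ in
        let rh : N := dih_rho _ in
        exists act : {multiplicative ('Z_2 : groupType) -> autom N},
          let om := sd_inr act (1%R : 'Z_2) in
          [/\ om * sd_inl act al * om^-1
                = sd_inl act (al ^z r * be ^z (s * t)%R),
              om * sd_inl act be * om^-1 = sd_inl act (al * be ^z r),
              om * sd_inl act rh * om^-1
                = sd_inl act (al ^z t * be ^z (t * (r + 1))%R * rh)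
            & isomorphic (outer (sapphire B)) (semidirect_group act)]
    & (* III *)
      forall (M0 : 'M[int]_2) (l0 l r s t : int),
        centralizer_root (theta B) M0 ->
        aut01 B !=set0 ->
        l0 = (2 * l)%R -> theta B = (- (M0 ^ l0))%R ->
        (\det (M0 ^ l) = -1)%R -> (M0 ^ l)%R = mx22 r s t r ->
        B = mx22 r (- t)%R s (- r)%R ->
        let N := dih `|(2 * t)%R|%N in
        exists (i : {multiplicative N -> outer (sapphire B)})
               (p : {multiplicative outer (sapphire B) -> ('Z_2 : groupType)})
               (om : outer (sapphire B)),
          short_exact i p /\
          presents (out4_rels r s t)
            (fun g => match g with
                      | halpha => i (dih_alpha _)
                      | hbeta => i (dih_beta _)
                      | hrho => i (dih_rho _)
                      | homega => om
                      end)].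
Proof.
split=> [r s t u no1 BE|M0 l0 l r s t _ _ _ _ _ _ BE N al be rh|M0 l0 l r s t _ _ _ _ _ _ BE N].
- subst B; apply: out_sapphire_dihedral => //; last exact: mx22_neq0.
  by rewrite -detB det_mx22.
- have detM : (r * r - s * t = 2 * 1 - 1)%R.
    by move: detB; rewrite BE det_mx22; lia.
  rewrite omega_matrix_det1 in BE; subst B; have nz := mx22_neq0 B_neq0.
  have cc : (1 = 0 :> int)%R \/ (1 = 1 :> int)%R by right.
  have [act [actE iso]] := split_extension (omega_dih_morph cc detM nz)
    (@omega_dih_inj _ _ _ _ cc detM nz) (@omega_dih_normal _ _ _ _ cc detM nz)
    (@omega_not_dih _ _ _ _ cc detM nz)
    (@omega_dih_cover _ _ _ _ cc detM nz) (ow_sq cc detM nz).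
  have k1 := @omega_order _ _ _ _ cc detM nz.
  have fM := omega_dih_morph cc detM nz.
  have fI := @omega_dih_inj _ _ _ _ cc detM nz.
  exists act => om; split=> //.
  + rewrite sd_conj; congr sd_inl; apply: fI; rewrite actE fM !(gmorph_gz fM).
    by rewrite dih_map_alpha dih_map_beta // ow_alpha.
  + rewrite sd_conj; congr sd_inl; apply: fI; rewrite actE fM !(gmorph_gz fM).
    by rewrite dih_map_alpha dih_map_beta // ow_beta.
  rewrite sd_conj; congr sd_inl; apply: fI; rewrite actE !fM !(gmorph_gz fM).
  by rewrite dih_map_alpha dih_map_beta // dih_map_rho ow_rho.
have detM : (r * r - s * t = 2 * 0 - 1)%R.
  by move: detB; rewrite BE det_mx22; lia.
rewrite omega_matrix_detN1 in BE; subst B; have nz := mx22_neq0 B_neq0.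
have cc : (0 = 0 :> int)%R \/ (0 = 1 :> int)%R by left.
have fM := omega_dih_morph cc detM nz.
have fI := @omega_dih_inj _ _ _ _ cc detM nz.
have k1 := @omega_order _ _ _ _ cc detM nz; have wsq := ow_sq cc detM nz.
have [|i [p [iE ip]]] := index_two_exact fM fI (@omega_dih_normal _ _ _ _ cc detM nz)
  (@omega_not_dih _ _ _ _ cc detM nz) (@omega_dih_cover _ _ _ _ cc detM nz).
  have [x xE] := omega_dih_word cc detM nz 0 t true.
  by exists x; rewrite wsq -xE mul1g.
exists i, p, (oclass (omega cc detM)); split=> //.
set x := (X in presents _ X).
have xa : x halpha = otwist (omega_det cc detM) false 1 r by rewrite /x iE dih_map_alpha.
have xb : x hbeta = otwist (omega_det cc detM) false 0 1 by rewrite /x iE dih_map_beta.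
have xr : x hrho = otwist (omega_det cc detM) true 0 t by rewrite /x iE dih_map_rho.
apply: out4_presentation; rewrite ?xa ?xb ?xr //.
- apply/out4_relsP; rewrite xa xb xr; split; first exact: omega_dih_relations.
  + by rewrite wsq.
  + exact: ow_alpha.
  + exact: ow_beta.
  exact: ow_rho.
- exact: omega_not_dih.
exact: omega_dih_cover.
Qed.
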